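(* Let $k\ge0$ be an integer, $\sigma>0$, $h>0$, and fix $\rho\in\mathcal P_2(\mathbb R^d)$. Let $\mu_t$ be the translate of $\rho$ by $x(t)$, i.e. $\mu_t=(z\mapsto z+x(t))_\#\rho$, where $x$ is the $\mathbb R^d$-valued process with $x^{(k+1)}(t)=\xi(t)$, $\xi$ white noise of intensity $\sigma^2I_d$. Then for every forecaster $\hat\nu\in\mathcal P_2(\mathbb R^d)$ that is measurable with respect to $\{\mu_u:u\le t_n\}$, $$\mathbb E\,W_2^2(\hat\nu,\mu_{t_n+h})\ \ge\ \frac{d\,\sigma^2\,h^{2k+1}}{(k!)^2(2k+1)},$$ and, within this model, equality holds for the order-$k$ Taylor extrapolator (the conditional mean), i.e. for $\hat\nu$ equal to the translate of $\rho$ by $\sum_{j=0}^k\frac{h^j}{j!}x^{(j)}(t_n)$.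
   Context: $\mathcal P_2(\mathbb R^d)$: Borel probability measures on $\mathbb R^d$ with finite second moment; $W_2$ the 2-Wasserstein distance. The equation $x^{(k+1)}=\xi$ is understood as: $x$ is $k$ times continuously differentiable and $dx^{(k)}(t)=\sigma\,dB_t$ with $B$ a standard $d$-dimensional Brownian motion, the initial jet $(x(0),\dots,x^{(k)}(0))$ being independent of $B$. The past is observed on $[0,t_n]$ with $t_n>0$. *)

(* Defs.v *)
From HB Require Import structures.
From mathcomp Require Import all_boot all_order all_algebra.
From mathcomp Require Import all_classical all_reals all_analysis.
From mathcomp Require Import measurable_realfun.

Set Implicit Arguments.
Unset Strict Implicit.
Unset Printing Implicit Defensive.
Import Order.TTheory GRing.Theory Num.Theory.
Import numFieldNormedType.Exports.

Local Open Scope classical_set_scope.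
Local Open Scope ring_scope.

(* R^d is [d.-tuple R]: its measurable structure is the product (hence Borel)
   sigma-algebra. *)
Section euclidean.
Context {R : realType} {d : nat}.
Implicit Types x y a : d.-tuple R.

Definition vzero : d.-tuple R := [tuple 0 | i < d].
Definition vadd x y : d.-tuple R := [tuple tnth x i + tnth y i | i < d].
Definition vsub x y : d.-tuple R := [tuple tnth x i - tnth y i | i < d].

Definition sqdist x y : R := \sum_(i < d) (tnth x i - tnth y i) ^+ 2.

Definition translation a : d.-tuple R -> d.-tuple R := fun z => vadd z a.

Lemma measurable_translation a : measurable_fun setT (translation a).
Proof.
apply/measurable_fun_tnthP => i.
rewrite (_ : _ \o _ = fun z : d.-tuple R => tnth z i + tnth a i); last first.
  by apply/funext => z /=; rewrite tnth_mktuple.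
by apply: measurable_funD; [exact: measurable_tnth|exact: measurable_cst].
Qed.

HB.instance Definition _ a :=
  isMeasurableFun.Build _ _ _ _ (translation a) (measurable_translation a).

End euclidean.

(* Probability measures on R^d carry the library's sigma-algebra generated by
   the evaluations [mu |-> mu A]; on P_2(R^d) it is the Borel sigma-algebra of
   the weak topology and of W_2. *)
Section wasserstein.
Context {R : realType} {d : nat}.
Local Notation Rd := (d.-tuple R).
Implicit Types mu nu rho : pprobability Rd R.

Definition finite_second_moment mu : Prop :=
  (\int[mu]_z (sqdist z vzero)%:E < +oo)%E.

Definition coupling mu nu : set (probability (Rd * Rd)%type R) :=
  [set g | forall A : set Rd, measurable A ->
     g (A `*` setT) = mu A /\ g (setT `*` A) = nu A].

Definition W2 mu nu : \bar R :=
  sqrte (ereal_inf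
    [set (\int[g]_z (sqdist z.1 z.2)%:E)%E | g in coupling mu nu]).

Definition translate rho (a : Rd) : pprobability Rd R :=
  distribution rho (translation a).

End wasserstein.

Section sigma_algebras.
Context {dO : measure_display} {Omega : measurableType dO}.

Definition sigma_of {d'} {T : measurableType d'} {I : Type} (D : set I)
    (f : I -> Omega -> T) : set (set Omega) :=
  <<s \bigcup_(i in D) preimage_set_system setT (f i) measurable >>.

Definition measurable_wrt {d'} {T : measurableType d'} (F : set (set Omega))
    (f : Omega -> T) : Prop :=
  preimage_set_system setT f measurable `<=` F.

Definition independent {R : realType} (P : probability Omega R)
    (F G : set (set Omega)) : Prop :=
  forall A B, F A -> G B -> P (A `&` B) = (P A * P B)%E.

(* [m] is the conditional mean of [Y] given [F]. Only [Y - m] is required to be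
   integrable, so that the notion makes sense when [Y] has no first moment; for
   integrable [Y] this is the usual E[Y | F]. *)
Definition conditional_mean {R : realType} {d : nat} (P : probability Omega R)
    (F : set (set Omega)) (Y m : Omega -> d.-tuple R) : Prop :=
  measurable_wrt F m /\
  forall i : 'I_d,
    P.-integrable setT (fun w => (tnth (Y w) i - tnth (m w) i)%:E) /\
    forall A, F A ->
      (\int[P]_(w in A) (tnth (Y w) i - tnth (m w) i)%:E = 0)%E.

End sigma_algebras.

Section processes.
Context {R : realType} {d : nat}.
Context {dO : measure_display} {Omega : measurableType dO}.
Variable P : probability Omega R.
Local Notation Rd := (d.-tuple R).

(* Processes are indexed by all of R, but only times t >= 0 are constrained. *)
Definition continuous_path (x : R -> Rd) : Prop :=
  forall i : 'I_d, {within `[0, +oo[, continuous (fun t => tnth (x t) i)}.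

(* The law of [Y] is N(0, v I_d), the d-fold product of N(0, v); measurable
   boxes determine it. [normal_prob] takes the standard deviation. *)
Definition centered_gaussian (v : R) (Y : Omega -> Rd) : Prop :=
  forall A : 'I_d -> set R, (forall i, measurable (A i)) ->
    (P [set w | forall i, A i (tnth (Y w) i)] =
     \prod_(i < d) normal_prob 0 (Num.sqrt v) (A i))%E.

Record standard_brownian (B : R -> Omega -> Rd) : Prop := {
  brownian_measurable : forall t : R, 0 <= t -> measurable_fun setT (B t);
  brownian_start : {ae P, forall w, B 0 w = vzero};
  brownian_continuous : {ae P, forall w, continuous_path (B ^~ w)};
  brownian_indep_increments : forall s t : R, 0 <= s -> s < t ->
    independent P
      (sigma_of `[0, s] B)
      (sigma_of [set: unit] (fun _ w => vsub (B t w) (B s w)));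
  brownian_gaussian_increments : forall s t : R, 0 <= s -> s < t ->
    centered_gaussian (t - s) (fun w => vsub (B t w) (B s w)) }.

(* [X j] is the j-th derivative x^(j) of the process x = [X 0], for j <= k.
   Derivatives are two-sided at t > 0; together with continuity on [0, +oo[
   this says that x is C^k on [0, +oo[ with one-sided derivatives at 0. *)
Record integrated_white_noise (k : nat) (sigma : R)
    (X : nat -> R -> Omega -> Rd) (B : R -> Omega -> Rd) : Prop := {
  iwn_measurable : forall j (t : R), (j <= k)%N -> 0 <= t ->
    measurable_fun setT (X j t);
  iwn_continuous : forall j w, (j <= k)%N -> continuous_path (X j ^~ w);
  iwn_derive : forall j (w : Omega) (i : 'I_d) (t : R), (j < k)%N -> 0 < t ->
    is_derive t 1 (fun s : R => tnth (X j s w) i) (tnth (X j.+1 t w) i);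
  iwn_brownian : standard_brownian B;
  (* the integrated form of d x^(k) = sigma dB *)
  iwn_noise : {ae P, forall w, forall (t : R) (i : 'I_d), 0 <= t ->
    tnth (X k t w) i = tnth (X k 0 w) i + sigma * tnth (B t w) i};
  iwn_indep : independent P
    (sigma_of [set j | (j <= k)%N] (fun j => X j 0))
    (sigma_of `[0, +oo[ B) }.

Definition taylor (k : nat) (h t : R) (X : nat -> R -> Omega -> Rd) :
    Omega -> Rd :=
  fun w => [tuple \sum_(j < k.+1) h ^+ j / j`!%:R * tnth (X j t w) i | i < d].

Definition forecaster (F : set (set Omega)) (nu : Omega -> pprobability Rd R) :
    Prop :=
  (forall w, finite_second_moment (nu w)) /\ measurable_wrt F nu.

End processes.

(* Main.v *)
(* Conditionally on the past, the error of the Taylor extrapolator from t_n is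
   centered.  Put Q(t) = sum_l (T - t)^l / l! x^(l)(t) with T = t_n + h, so that
   the error is Q(T) - Q(t_n).  On a subinterval [t, t + c] the increment of Q
   is sum_l (T - t - c)^l / l! r_l, where r_l is the remainder of the Taylor
   expansion of x^(l) at t; r_k = sigma (B(t + c) - B(t)) almost surely, and
   E r_l^2 <= sigma^2 c^(2 (k - l) + 1).  Over n subintervals the terms l < k
   therefore contribute O(1/n) to the second moment, and the error is the L^2
   limit of weighted sums of Brownian increments: it is orthogonal to the past,
   with variance per coordinate the limit of a Riemann sum of
   sigma^2 (T - t)^(2 k) / k!^2.
   The squared W_2 distance dominates the squared distance of the means, with
   equality for two translates of rho; the mean of a forecast being measurable
   with respect to the past, Pythagoras gives the bound. *)

Require Import Defs.
From HB Require Import structures.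
From mathcomp Require Import all_boot all_order all_algebra.
From mathcomp Require Import all_classical all_reals all_analysis.
From mathcomp Require Import measurable_realfun ring lra.
Import Order.TTheory GRing.Theory Num.Theory.
Import numFieldNormedType.Exports.

Set Implicit Arguments.
Unset Strict Implicit.
Unset Printing Implicit Defensive.

Local Open Scope classical_set_scope.
Local Open Scope ring_scope.

(** * Square-integrable functions *)

(** The limit in question is [sigma] times the Wiener integral of (T - t)^k / k! against [B]. Only
    its inner products are ever used, and these pass to the limit along the finite sums, so no
    stochastic integral is constructed. The initial jet may have no moments, so neither x(T) nor its
    prediction need be integrable; the estimates therefore concern Taylor remainders only, in which
    the jet cancels. The relation between x^(k) and [B] holds only almost surely, whereas the past
    is generated by the paths themselves. Orthogonality is thus proved against a larger
    sigma-algebra, generated by the jet, the noise up to t_n and all almost sure events. In the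
    other direction the extrapolator has to be a function of the observed measures: the mean of mu_u
    reveals x(u), and left difference quotients at times in ]0, t_n] reveal the derivatives; this is
    where t_n > 0 enters. *)

Section square_integrable.
Context {R : realType} {dO : measure_display} {Omega : measurableType dO}.
Variable P : probability Omega R.
Implicit Types f g : Omega -> R.

(** Genuine functions, not classes modulo null sets: pathwise identities stay equalities of
    functions, and almost sure ones are carried over by [L2_ae] and [inner_ae]. *)
Definition L2 f :=
  measurable_fun setT f /\ P.-integrable setT (fun w => (f w ^+ 2)%:E).

Definition inner f g : R := \int[P]_w (f w * g w).

Lemma L2_integrableM f g : L2 f -> L2 g ->
  P.-integrable setT (fun w => (f w * g w)%:E).
Proof.
move=> [mf If] [mg Ig].
apply: (le_integrable measurableT _ _ (integrableD measurableT If Ig)).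
  by apply/measurable_EFinP; exact: measurable_funM.
move=> w _; rewrite lee_fin normrM.
rewrite [leRHS]ger0_norm ?addr_ge0 ?sqr_ge0//.
rewrite -(real_normK (num_real (f w))) -(real_normK (num_real (g w))).
have := sqr_ge0 (`|f w| - `|g w|).
have := normr_ge0 (f w); have := normr_ge0 (g w); nra.
Qed.

Lemma L2_bounded f (M : R) : measurable_fun setT f ->
  (forall w, `|f w| <= M) -> L2 f.
Proof.
move=> mf fM; split => //.
apply: measurable_bounded_integrable => //.
- by rewrite (le_lt_trans (probability_le1 P measurableT))// ltry.
- exact: measurable_funX.
- exists (M ^+ 2); split; first exact: num_real.
  move=> x Mx w _ /=; rewrite ger0_norm ?sqr_ge0// (le_trans _ (ltW Mx))//.
  rewrite -(real_normK (num_real (f w))) lerXn2r ?nnegrE//.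
  by rewrite (le_trans _ (fM w)).
Qed.

Lemma L2_cst (c : R) : L2 (cst c).
Proof. by apply: (@L2_bounded _ `|c|) => //; exact: measurable_cst. Qed.

Lemma L2Z (c : R) f : L2 f -> L2 (fun w => c * f w).
Proof.
move=> [mf If]; split; first exact: measurable_funM.
rewrite (_ : (fun _ => _) = (fun w => (c ^+ 2)%:E * (f w ^+ 2)%:E)%E).
  exact: integrableZl.
by apply/funext => w; rewrite -EFinM exprMn.
Qed.

Lemma L2_le f g : measurable_fun setT f -> L2 g ->
  (forall w, f w ^+ 2 <= g w ^+ 2) -> L2 f.
Proof.
move=> mf [mg Ig] fg; split => //.
apply: (le_integrable measurableT _ _ Ig).
  by apply/measurable_EFinP; exact: measurable_funX.
by move=> w _; rewrite lee_fin !ger0_norm ?sqr_ge0.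
Qed.

Lemma L2D f g : L2 f -> L2 g -> L2 (fun w => f w + g w).
Proof.
move=> Lf Lg; have := L2_integrableM Lf Lg.
move: Lf Lg => [mf If] [mg Ig] Ifg; split; first exact: measurable_funD.
rewrite (_ : (fun _ => _) =
  (fun w => (f w ^+ 2)%:E + (2%:E * (f w * g w)%:E + (g w ^+ 2)%:E))%E).
  apply: integrableD => //; apply: integrableD => //; exact: integrableZl.
by apply/funext => w; rewrite -EFinM -!EFinD; congr EFin; ring.
Qed.

Lemma L2B f g : L2 f -> L2 g -> L2 (fun w => f w - g w).
Proof.
move=> Lf /(L2Z (-1)) Lg; rewrite (_ : (fun _ => _) = fun w => f w + -1 * g w).
  exact: L2D.
by apply/funext => w; rewrite mulN1r.
Qed.

Lemma L2_sum (I : Type) (r : seq I) (p : pred I) (F : I -> Omega -> R) :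
  (forall i, p i -> L2 (F i)) -> L2 (fun w => \sum_(i <- r | p i) F i w).
Proof.
move=> LF; elim: r => [|i r IHr].
  rewrite (_ : (fun _ => _) = cst 0); first exact: L2_cst.
  by apply/funext => w; rewrite big_nil.
case: (boolP (p i)) => [pi|/negPf npi].
  rewrite (_ : (fun _ => _) =
    fun w => F i w + \sum_(j <- r | p j) F j w); first by apply: L2D => //; exact: LF.
  by apply/funext => w; rewrite big_cons pi.
rewrite (_ : (fun _ => _) = fun w => \sum_(j <- r | p j) F j w)//.
by apply/funext => w; rewrite big_cons npi.
Qed.

Lemma L2_ae f g : measurable_fun setT f -> L2 g ->
  {ae P, forall w, f w = g w} -> L2 f.
Proof.
move=> mf [mg /integrableP[mg2 Ig]] fg; split => //; apply/integrableP; split.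
  by apply/measurable_EFinP; exact: measurable_funX.
rewrite (ae_eq_integral (fun w => `|(g w ^+ 2)%:E|)%E)//.
- by apply: measurableT_comp => //; apply/measurable_EFinP; exact: measurable_funX.
- by apply: measurableT_comp => //; apply/measurable_EFinP; exact: measurable_funX.
- by apply: filterS fg => w /= -> _.
Qed.

Lemma innerC f g : inner f g = inner g f.
Proof. by apply: eq_Rintegral => w _; rewrite mulrC. Qed.

Lemma innerDr f g1 g2 : L2 f -> L2 g1 -> L2 g2 ->
  inner f (fun w => g1 w + g2 w) = inner f g1 + inner f g2.
Proof.
move=> Lf L1 L2'; rewrite /inner -RintegralD//; try exact: L2_integrableM.
by apply: eq_Rintegral => w _; rewrite mulrDr.
Qed.

Lemma innerBr f g1 g2 : L2 f -> L2 g1 -> L2 g2 ->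
  inner f (fun w => g1 w - g2 w) = inner f g1 - inner f g2.
Proof.
move=> Lf L1 L2'; rewrite /inner -RintegralB//; try exact: L2_integrableM.
by apply: eq_Rintegral => w _; rewrite mulrBr.
Qed.

Lemma innerZr (c : R) f g : L2 f -> L2 g ->
  inner f (fun w => c * g w) = c * inner f g.
Proof.
move=> Lf Lg; rewrite /inner -RintegralZl//; try exact: L2_integrableM.
by apply: eq_Rintegral => w _; rewrite mulrCA.
Qed.

Lemma inner_sumr (I : Type) (r : seq I) f (F : I -> Omega -> R) :
  L2 f -> (forall i, L2 (F i)) ->
  inner f (fun w => \sum_(i <- r) F i w) = \sum_(i <- r) inner f (F i).
Proof.
move=> Lf LF; elim: r => [|i r IHr].
  rewrite big_nil /inner (eq_Rintegral _ (g := cst 0)).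
    by rewrite Rintegral_cst// mul0r.
  by move=> w _; rewrite big_nil mulr0.
rewrite big_cons -IHr -innerDr//; last exact: L2_sum.
by apply: eq_Rintegral => w _; rewrite big_cons.
Qed.

Lemma inner_cst (a b : R) : inner (cst a) (cst b) = a * b.
Proof.
rewrite /inner (eq_Rintegral _ (g := cst (a * b)))//.
rewrite Rintegral_cst// -[RHS]mulr1; congr (_ * _).
exact: (congr1 fine (probability_setT P)).
Qed.

Lemma inner_ge0 f : 0 <= inner f f.
Proof. by apply: Rintegral_ge0 => w _; rewrite -expr2 sqr_ge0. Qed.

Lemma EFin_inner f : L2 f ->
  (\int[P]_w (f w ^+ 2)%:E)%E = (inner f f)%:E.
Proof.
move=> [_ If]; rewrite /inner /Rintegral fineK.
  by apply: eq_integral => w _; rewrite expr2.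
by have := integrable_fin_num measurableT If.
Qed.

Lemma inner_sqrB f g : L2 f -> L2 g ->
  inner (fun w => f w - g w) (fun w => f w - g w) =
  inner f f - 2 * inner f g + inner g g.
Proof.
move=> Lf Lg; have Lfg := L2B Lf Lg.
rewrite innerBr// (innerC _ f) (innerC _ g) innerBr// innerBr//.
by rewrite (innerC g f); ring.
Qed.

(** The quadratic c |-> |f - c g|^2 is nonnegative; it is evaluated at its minimiser when
    [inner g g] is positive. *)
Lemma cauchy_schwarz_inner f g : L2 f -> L2 g ->
  inner f g ^+ 2 <= inner f f * inner g g.
Proof.
move=> Lf Lg.
have key (c : R) : 0 <= inner f f - 2 * c * inner f g + c ^+ 2 * inner g g.
  have LG := L2Z c Lg.
  have := inner_ge0 (fun w => f w - c * g w).
  rewrite inner_sqrB// (innerZr c Lf Lg) (innerZr c LG Lg).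
  rewrite (innerC (fun w => c * g w)) (innerZr c Lg Lg).
  by rewrite (_ : _ + _ = inner f f - 2 * c * inner f g + c ^+ 2 * inner g g)//; ring.
have := inner_ge0 g; rewrite le_eqVlt => /orP[/eqP g0|g0]; last first.
  have := mulr_ge0 (key (inner f g / inner g g)) (ltW g0).
  suff -> : (inner f f - 2 * (inner f g / inner g g) * inner f g +
    (inner f g / inner g g) ^+ 2 * inner g g) * inner g g =
    inner f f * inner g g - inner f g ^+ 2 by rewrite subr_ge0.
  by field; rewrite gt_eqF.
rewrite -g0 mulr0 leNgt; apply/negP => fg0.
have ne0 : inner f g != 0 by apply/eqP => h0; rewrite h0 expr0n ltxx in fg0.
(* With [inner g g = 0] the quadratic is affine in c, and this c would give it the value -1. *)
have := key ((inner f f + 1) / (2 * inner f g)).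
rewrite -g0 mulr0 addr0.
rewrite (_ : _ - _ = -1); first by rewrite lerNr oppr0 ler10.
by field.
Qed.

End square_integrable.

(** * Riemann sums *)

Section riemann_sums.
Context {R : realType}.
Implicit Types f g : R -> R.

Lemma within_ge0_continuousP g : {within `[0, +oo[, continuous g} ->
  forall x e, 0 <= x -> 0 < e ->
  exists2 dl, 0 < dl & forall y, 0 <= y -> `|x - y| < dl -> `|g x - g y| < e.
Proof.
move=> /subspace_continuousP cg x e x0 e0.
have /cg /cvgrPdist_lt/(_ _ e0) : `[0, +oo[%classic x by rewrite /= in_itv/= x0.
rewrite /prop_near1 /within /= => /nbhs_ballP[dl /= dl0 xdl].
by exists dl => // y y0 xy; apply: xdl => //=; rewrite in_itv/= y0.
Qed.

(** Heine-Cantor in near-covering form: each point of [0, b] has a neighbourhood and a scale that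
    suit it, and compactness makes the scale common. *)
Lemma within_ge0_unif_continuous g (b : R) : {within `[0, +oo[, continuous g} ->
  forall e, 0 < e -> exists2 dl, 0 < dl &
  forall x y, 0 <= x <= b -> 0 <= y -> `|x - y| < dl -> `|g x - g y| < e.
Proof.
move=> cg e e0.
have /compact_near_coveringP Kcov := @segment_compact R 0 b.
pose Q dl x := 0 <= x -> forall y, 0 <= y -> `|x - y| < dl -> `|g x - g y| < e.
have : \forall dl \near 0^'+, `[0, b]%classic `<=` Q dl.
  apply: Kcov => x /=; rewrite in_itv/= => /andP[x0 _].
  have e20 : 0 < e / 2 by lra.
  have [dl dl0 xdl] := within_ge0_continuousP cg x0 e20.
  near=> x' dl'.
  move=> /= x'0 y y0 x'y.
  have xx' : `|x - x'| < dl / 2.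
    by near: x'; apply/nbhs_ballP; exists (dl / 2) => //=; lra.
  have dl'dl : dl' < dl / 2 by near: dl'; apply: nbhs_right_lt; lra.
  have h1 : `|g x - g x'| < e / 2 by apply: xdl => //; lra.
  have h2 : `|g x - g y| < e / 2.
    by apply: xdl => //; have := ler_distD x' x y; lra.
  by have := ler_distD (g x) (g x') (g y); rewrite (distrC (g x') (g x)); lra.
move=> near0; near (0 : R)^'+ => dl.
exists dl; first by near: dl; exact: nbhs_right_gt.
move=> x y xb y0 xy.
have Qdl : `[0, b]%classic `<=` Q dl by near: dl.
by apply: (Qdl x) => //=; case/andP: xb.
Unshelve. all: by end_near. Qed.

(* The mean value theorem on each subinterval, and uniform continuity of [g]. *)
Lemma cvg_riemann_sum f g (t u : R) : 0 <= t -> 0 <= u ->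
  {within `[0, +oo[, continuous f} -> {within `[0, +oo[, continuous g} ->
  (forall s : R, 0 < s -> is_derive s 1 f (g s)) ->
  (fun n => \sum_(i < n.+1) g (t + i%:R * (u / n.+1%:R)) * (u / n.+1%:R)) @ \oo
  --> f (t + u) - f t.
Proof.
move=> t0; rewrite le_eqVlt => /orP[/eqP <- _ _ _|u0 cf cg fg].
  rewrite addr0 subrr (_ : (fun _ => _) = cst 0); first exact: cvg_cst.
  apply/funext => n; rewrite big1// => i _; ring.
apply/cvgrPdist_le => e e0.
have eu0 : 0 < e / u by exact: divr_gt0.
have [dl dl0 gdl] := within_ge0_unif_continuous (t + u) cg eu0.
near=> n.
pose c := u / n.+1%:R.
have n0 : 0 < n.+1%:R :> R by rewrite ltr0n.
have c0 : 0 < c by exact: divr_gt0.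
have cdl : c < dl.
  rewrite ltr_pdivrMr// mulrC -ltr_pdivrMr//.
  apply: (@lt_trans _ _ n%:R); last by rewrite ltr_nat.
  by near: n; exact: nbhs_infty_gtr.
have nc : n.+1%:R * c = u by rewrite /c mulrC divfK// gt_eqF.
have telesc : f (t + u) - f t =
    \sum_(i < n.+1) (f (t + i.+1%:R * c) - f (t + i%:R * c)).
  rewrite -(big_mkord xpredT (fun i => f (t + i.+1%:R * c) - f (t + i%:R * c))).
  by rewrite (telescope_sumr (fun i => f (t + i%:R * c)))// nc mul0r addr0.
rewrite telesc -sumrB (le_trans (ler_norm_sum _ _ _))//.
rewrite (_ : e = \sum_(i < n.+1) (e / u * c)); last first.
  rewrite sumr_const card_ord -mulr_natl mulrCA nc divfK// gt_eqF//.
apply: ler_sum => i _.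
have iS : i.+1%:R * c = i%:R * c + c by rewrite -natr1; ring.
have ic0 : 0 <= i%:R * c by rewrite mulr_ge0// ltW.
have iu : i%:R * c + c <= u.
  by rewrite -iS -nc ler_pM2r// ler_nat.
have [|x xi||y yi ->] := @MVT R f g (t + i%:R * c) (t + i.+1%:R * c).
- by rewrite iS; lra.
- by apply: fg; move: xi; rewrite in_itv/= => /andP[]; lra.
- apply: continuous_subspaceW cf => y /=; rewrite !in_itv/= andbT => /andP[]; lra.
rewrite iS (_ : t + (i%:R * c + c) - (t + i%:R * c) = c); last ring.
rewrite -/c -mulrBl normrM (gtr0_norm c0) ler_pM2r//.
move: yi; rewrite in_itv/= iS => /andP[y1 y2].
apply/ltW/gdl; [lra|lra|].
by rewrite ltr_norml; lra.
Unshelve. all: by end_near. Qed.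

(** With [m = 2 * k] this is the source of the factor 1 / (2k + 1) in the bound. *)
Lemma cvg_riemann_sum_pow (m : nat) :
  (fun n => \sum_(i < n.+1) (i%:R / n.+1%:R : R) ^+ m / n.+1%:R) @ \oo
  --> (m.+1%:R^-1 : R).
Proof.
have := @cvg_riemann_sum (fun s => s ^+ m.+1 / m.+1%:R) (fun s => s ^+ m) 0 1.
rewrite add0r expr1n expr0n/= mul0r subr0 div1r => H.
have {}H := H (lexx _) ler01 _ _ _.
rewrite (_ : (fun _ => _) = (fun n => \sum_(i < n.+1)
    (0 + i%:R * (1 / n.+1%:R)) ^+ m * (1 / n.+1%:R))); last first.
  by apply/funext => n; apply: eq_bigr => i _; rewrite add0r !div1r.
apply: H.
- apply: continuous_subspaceT => s.
  by apply: cvgM; [exact: exprn_continuous|exact: cvg_cst].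
- by apply: continuous_subspaceT => s; exact: exprn_continuous.
move=> s _.
have -> : s ^+ m = m.+1%:R^-1 * (m.+1%:R * s ^+ m) by rewrite mulKf.
rewrite (_ : (fun _ => _) = m.+1%:R^-1 *: (fun x : R => x ^+ m.+1)); last first.
  by apply/funext => x; rewrite /= mulrC.
apply: is_deriveZ.
rewrite (_ : (fun x => _) = (id : R -> R) ^+ m.+1); last first.
  by apply/funext => x; rewrite exprfctE.
by apply: is_derive_eq; rewrite /GRing.scale/= mulr1.
Qed.

End riemann_sums.

(** * Limits in mean square *)

Section square_integrable_limits.
Context {R : realType} {dO : measure_display} {Omega : measurableType dO}.
Variable P : probability Omega R.
Implicit Types f g : Omega -> R.

(** Riemann sums along a path converge for each outcome separately, with no uniformity. Fatou still
    transfers a common bound on second moments, and an inequality is all that the remainders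
    require. *)
Lemma L2_fatou (S : nat -> Omega -> R) f (M : R) :
  (forall n, L2 P (S n)) -> (forall n, inner P (S n) (S n) <= M) ->
  (forall w, S ^~ w @ \oo --> f w) -> L2 P f /\ inner P f f <= M.
Proof.
move=> LS SM Sf.
have mf : measurable_fun setT f.
  by apply: (@measurable_fun_cvg _ _ _ _ S) => // m; exact: (LS m).1.
have fM : (\int[P]_w (f w ^+ 2)%:E <= M%:E)%E.
  have fE w : (f w ^+ 2)%:E = limn_einf (fun n => (S n w ^+ 2)%:E).
    rewrite limn_einf_lim; apply/esym/cvg_lim => //; apply: cvg_einfs.
    apply: cvg_EFin; first exact: nearW.
    by apply: (cvg_comp _ (fun x : R => x ^+ 2)); [exact: Sf|exact: sqr_continuous].
  under eq_integral do rewrite fE.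
  apply: (le_trans (fatou _ measurableT _ _)).
  - by move=> n; apply/measurable_EFinP/measurable_funX; exact: (LS n).1.
  - by move=> n w _; rewrite lee_fin sqr_ge0.
  rewrite limn_einf_lim; apply: lime_le; first exact: is_cvg_einfs.
  apply: nearW => n; apply: (@le_trans _ _ (\int[P]_w (S n w ^+ 2)%:E)%E).
    by apply: ereal_inf_lbound; exists n => /=.
  by rewrite EFin_inner// lee_fin.
have Lf : L2 P f.
  split => //; apply/integrableP; split.
    by apply/measurable_EFinP; exact: measurable_funX.
  under eq_integral do rewrite gee0_abs ?lee_fin ?sqr_ge0//.
  exact: le_lt_trans fM (ltry _).
by split => //; rewrite -lee_fin -EFin_inner.
Qed.

Lemma cvg0_sqr_le_harmonic (u : nat -> R) (K : R) : 0 <= K ->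
  (forall n, u n ^+ 2 <= K / n.+1%:R) -> u @ \oo --> (0 : R).
Proof.
move=> K0 uK; apply/cvgrPdist_le => e e0.
near=> n; rewrite sub0r normrN -(@ler_pXn2r _ 2 isT) ?nnegrE ?(ltW e0)//.
rewrite real_normK ?num_real//.
rewrite (le_trans (uK n))//.
rewrite ler_pdivrMr// mulrC -ler_pdivrMr ?exprn_gt0//.
apply: (@le_trans _ _ n%:R); last by rewrite ler_nat.
by apply: ltW; near: n; exact: nbhs_infty_gtr.
Unshelve. all: by end_near. Qed.

Lemma cvg_inner_approx (V f : Omega -> R) (N : nat -> Omega -> R) (C : R) :
  L2 P V -> L2 P f -> (forall n, L2 P (N n)) ->
  (forall n, inner P (fun w => f w - N n w) (fun w => f w - N n w) <=
     C / n.+1%:R) ->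
  (fun n => inner P V (N n)) @ \oo --> inner P V f.
Proof.
move=> LV Lf LN fN.
have C0 : 0 <= C.
  by have := le_trans (inner_ge0 _ _) (fN 0); rewrite divr1.
have H : (fun n => inner P V (fun w => f w - N n w)) @ \oo --> (0 : R).
  apply: (@cvg0_sqr_le_harmonic _ (inner P V V * C)).
    by rewrite mulr_ge0// inner_ge0.
  move=> n; rewrite (le_trans (cauchy_schwarz_inner _ _))//.
    exact: L2B.
  by rewrite -mulrA ler_wpM2l ?inner_ge0.
rewrite (_ : (fun n => inner P V (N n)) =
  (fun n => inner P V f - inner P V (fun w => f w - N n w))).
  by rewrite -[X in _ --> X]subr0; apply: cvgB => //; exact: cvg_cst.
by apply/funext => n; rewrite innerBr//; ring.
Qed.

Lemma cvg_inner_approx_diag f (N : nat -> Omega -> R) (C : R) :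
  L2 P f -> (forall n, L2 P (N n)) ->
  (forall n, inner P (fun w => f w - N n w) (fun w => f w - N n w) <=
     C / n.+1%:R) ->
  (fun n => inner P (N n) (N n)) @ \oo --> inner P f f.
Proof.
move=> Lf LN fN.
have C0 : 0 <= C.
  by have := le_trans (inner_ge0 _ _) (fN 0); rewrite divr1.
have Hd : (fun n => inner P (fun w => f w - N n w) (fun w => f w - N n w))
    @ \oo --> (0 : R).
  have HC : (fun n => C * harmonic n) @ \oo --> (0 : R).
    by rewrite -(mulr0 C); apply: cvgM; [exact: cvg_cst|exact: cvg_harmonic].
  apply: (@squeeze_cvgr _ _ _ _ (cst 0) (fun n => C * harmonic n)) => //.
    by apply: nearW => n; rewrite inner_ge0/= fN.
  exact: cvg_cst.
(* Expanding |f - N|^2 leaves the cross term, which is [cvg_inner_approx] with [V = f]. *)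
rewrite (_ : (fun n => inner P (N n) (N n)) = (fun n =>
  inner P (fun w => f w - N n w) (fun w => f w - N n w) +
  (2 * inner P f (N n) - inner P f f))).
  rewrite -[X in _ --> X]add0r; apply: cvgD => //.
  rewrite [X in _ --> X](_ : _ = 2 * inner P f f - inner P f f); last by ring.
  apply: cvgB; last exact: cvg_cst.
  by apply: cvgM; [exact: cvg_cst|exact: (cvg_inner_approx Lf Lf LN fN)].
by apply/funext => n; rewrite inner_sqrB//; ring.
Qed.

End square_integrable_limits.

(** * Moments of the centered normal law *)

Section normal_moments.
Context {R : realType}.
Variable s : R.
Hypothesis s0 : s != 0.
Local Notation leb := (@lebesgue_measure R).
Local Notation pdf := (normal_pdf 0 s).

Lemma ge0_integral_normal_prob (f : R -> R) :
  measurable_fun setT f -> (forall x, 0 <= f x) ->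
  (\int[normal_prob 0 s]_x (f x)%:E = \int[leb]_x (f x * pdf x)%:E)%E.
Proof.
move=> mf f0; have dom := @normal_prob_dominates R 0 s.
rewrite -(Radon_Nikodym_SigmaFinite.change_of_variables dom)//; last first.
  exact/measurable_EFinP.
apply: ae_eq_integral => //.
- apply: emeasurable_funM; first exact/measurable_EFinP.
  exact: measurable_int (Radon_Nikodym_SigmaFinite.f_integrable dom).
- apply/measurable_EFinP; apply: measurable_funM => //.
  exact: measurable_normal_pdf.
under [X in ae_eq _ _ _ X]eq_fun do rewrite EFinM.
(* The Radon-Nikodym derivative is known only through its integrals; these agree with those of [pdf]
   on every measurable set, so the two densities agree almost everywhere. *)
apply: ae_eqe_mul2l; apply: integral_ae_eq => //.
- exact: Radon_Nikodym_SigmaFinite.f_integrable.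
- by apply/measurable_EFinP; exact: measurable_normal_pdf.
- by move=> A _ mA; rewrite -Radon_Nikodym_SigmaFinite.f_integral.
Qed.

(** Integrability allows the line to be exhausted by symmetric intervals, by dominated convergence;
    hence only the symmetric boundary term of [F] has to vanish. *)
Lemma integral0_FTC (f F : R -> R) :
  continuous f -> leb.-integrable setT (EFin \o f) ->
  (forall x : R, is_derive x 1 F (f x)) ->
  (fun n => F n.+1%:R - F (- n.+1%:R)) @ \oo --> (0 : R) ->
  (\int[leb]_x (f x)%:E = 0)%E.
Proof.
move=> cf intf Ff F0.
pose D n := `[- n.+1%:R, n.+1%:R]%classic : set R.
pose h n := (EFin \o f) \_ (D n).
have [|||||_ _] := @dominated_convergence _ _ R leb setT measurableT h (EFin \o f)
  (fun x => `|(f x)%:E|%E).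
- move=> n; apply: (measurable_restrictT (EFin \o f) (measurable_itv _)).1.
  by apply: measurable_funTS; exact: measurable_int intf.
- exact: measurable_int intf.
- apply: nearW => x _; apply: cvg_near_cst.
  near=> n; rewrite /h patchE mem_set//= /D/= in_itv/= -ler_norml.
  apply: (@le_trans _ _ n%:R); last by rewrite ler_nat.
  by near: n; exact: nbhs_infty_ger.
- exact: integrable_abse.
- apply: nearW => x n _; rewrite /h patchE; case: ifPn => // _.
  by rewrite abse0.
move=> cv; apply: (etrans (esym (cvg_lim _ cv))) => //; apply/cvg_lim => //.
rewrite (_ : [sequence _]_n = (fun n => (F n.+1%:R - F (- n.+1%:R))%:E)).
  by apply: cvg_EFin => //; exact: nearW.
apply/funext => n; rewrite /= /h -integral_mkcond /D EFinB.
have FD (x : R) : derivable F x 1 by have [] := Ff x.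
have Fc (x : R) : {for x, continuous F}.
  by apply: differentiable_continuous; exact/derivable1_diffP.
apply: continuous_FTC2.
- by apply: (@lt_trans _ _ 0); rewrite ?oppr_lt0 ltr0n.
- exact: continuous_subspaceT.
- split.
  + by move=> x _.
  + by apply: cvg_at_right_filter; exact: Fc.
  + by apply: cvg_at_left_filter; exact: Fc.
- by move=> x _; rewrite derive1E; apply: derive_val.
Unshelve. all: by end_near. Qed.

Lemma normal_pdf0E x : pdf x = normal_peak s * expR (- (x ^+ 2 / (2 * s ^+ 2))).
Proof.
rewrite normal_pdfE// /normal_fun subr0 mulNr; congr (_ * expR (- (_ / _))).
by rewrite mulr_natl.
Qed.

Lemma mulr_expRN_le1 (y : R) : y * expR (- y) <= 1.
Proof.
rewrite expRN ler_pdivrMr ?expR_gt0// mul1r.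
by have := expR_ge1Dx y; lra.
Qed.

Lemma is_derive_normal_pdf (x : R) : is_derive x 1 pdf (- x / s ^+ 2 * pdf x).
Proof.
rewrite (_ : normal_pdf 0 s = fun y => normal_peak s *
    (expR \o (fun z => - (2 * s ^+ 2)^-1 * z ^+ 2)) y); last first.
  by apply/funext => y; rewrite normal_pdf0E/= mulNr (mulrC (y ^+ 2)).
have H1 : is_derive x 1 (fun z : R => z ^+ 2) (2 * x).
  rewrite (_ : (fun z => _) = (id : R -> R) ^+ 2); last first.
    by apply/funext => z; rewrite exprfctE.
  by apply: is_derive_eq; rewrite /GRing.scale/= mulr1 expr1.
have H2 : is_derive x 1 (fun z : R => - (2 * s ^+ 2)^-1 * z ^+ 2)
    (- (2 * s ^+ 2)^-1 * (2 * x)).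
  exact: (is_deriveZ (- (2 * s ^+ 2)^-1)).
have H3 := is_derive1_comp (is_derive_expR _) H2.
apply: is_derive_eq (is_deriveZ (normal_peak s) H3) _.
rewrite /GRing.scale/=; field.
by rewrite s0.
Qed.

Lemma continuous_normal_pdf0 : continuous pdf.
Proof. exact: continuous_normal_pdf. Qed.

Lemma integrable_sqr_normal_pdf :
  leb.-integrable setT (fun x => (x ^+ 2 * pdf x)%:E).
Proof.
have s20 : 0 < s ^+ 2 by rewrite exprn_even_gt0.
have s2n0 : 2 * s != 0 by rewrite mulf_neq0.
(* The dominating function is a multiple of the density of deviation 2s. With y = x^2 / (4 s^2), x^2
   exp(-2y) = 4 s^2 y exp(-2y) <= 4 s^2 exp(-y) <= 4 s^2 exp(-y/2), and exp(-y/2) is the shape of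
   that density. *)
pose K := 4 * s ^+ 2 * normal_peak s / normal_peak (2 * s).
have := integrableZl measurableT K (integrable_normal_pdf 0 (2 * s)).
apply: le_integrable => //.
  apply/measurable_EFinP/measurable_funM => //; last exact: measurable_normal_pdf.
move=> x _; rewrite lee_fin ger0_norm; last first.
  by rewrite mulr_ge0 ?sqr_ge0// normal_pdf_ge0.
rewrite (le_trans _ (ler_norm _))//.
have p0 := normal_peak_gt0 s2n0.
have p1 := normal_peak_gt0 s0.
rewrite (normal_pdfE _ s2n0) /normal_fun subr0 /K.
rewrite mulrA divfK ?gt_eqF// normal_pdf0E mulrCA [leRHS]mulrAC.
rewrite [leRHS]mulrC (ler_pM2l p1).
pose y := x ^+ 2 / (4 * s ^+ 2).
have -> : x ^+ 2 / (2 * s ^+ 2) = y + y by rewrite /y; field.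
have -> : - x ^+ 2 / ((2 * s) ^+ 2 *+ 2) = - y / 2 by rewrite /y; field.
have y0 : 0 <= y by rewrite divr_ge0 ?sqr_ge0// mulr_ge0// ltW.
have -> : x ^+ 2 = 4 * s ^+ 2 * y by rewrite /y; field.
have f4 : 0 < 4 * s ^+ 2 by apply: mulr_gt0.
rewrite -(mulrA (4 * s ^+ 2)) (ler_pM2l f4).
rewrite opprD expRD mulrA (le_trans (ler_wpM2r (expR_ge0 _) (mulr_expRN_le1 y)))//.
by rewrite mul1r ler_expR; lra.
Qed.

Lemma integral_sqr_normal_prob :
  (\int[normal_prob 0 s]_x (x ^+ 2)%:E = (s ^+ 2)%:E)%E.
Proof.
have s20 : 0 < s ^+ 2 by rewrite exprn_even_gt0.
rewrite ge0_integral_normal_prob//; last by move=> x; exact: sqr_ge0.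
have I2 := integrable_sqr_normal_pdf.
have I0 := integrable_normal_pdf 0 s.
(* Integration by parts in the form of an antiderivative: since pdf' = - x pdf / s^2, F' = x^2 pdf -
   s^2 pdf. *)
pose F x := - s ^+ 2 * (x * pdf x).
have : (\int[leb]_x (x ^+ 2 * pdf x - s ^+ 2 * pdf x)%:E = 0)%E.
  apply: (@integral0_FTC _ F).
  - move=> x; apply: cvgB; apply: cvgM.
    + exact: exprn_continuous.
    + exact: continuous_normal_pdf0.
    + exact: cvg_cst.
    + exact: continuous_normal_pdf0.
  - rewrite (_ : _ \o _ = (fun x => (x ^+ 2 * pdf x)%:E -
      (s ^+ 2)%:E * (pdf x)%:E)%E); last by apply/funext => x /=.
    by apply: integrableB => //; exact: integrableZl.
  - move=> x; have H := is_deriveM (is_derive_id x 1) (is_derive_normal_pdf x).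
    apply: is_derive_eq (is_deriveZ (- s ^+ 2) H) _.
    by rewrite /GRing.scale/=; field.
  (* Chosen so that the boundary term is - K / a times y exp(-y) with y = a^2 / (2 s^2); as y
     exp(-y) <= 1, its square is at most K^2 / a^2 <= K^2 / a. *)
  - pose K := 4 * s ^+ 4 * normal_peak s.
    have p1 := normal_peak_gt0 s0.
    apply: (@cvg0_sqr_le_harmonic _ _ (K ^+ 2)); first exact: sqr_ge0.
    move=> n; set a : R := n.+1%:R.
    have a0 : 0 < a by rewrite ltr0n.
    rewrite (_ : F a - F (- a) = - (K / a * (a ^+ 2 / (2 * s ^+ 2) *
      expR (- (a ^+ 2 / (2 * s ^+ 2)))))); last first.
      rewrite /F !normal_pdf0E sqrrN /K; field.
      by rewrite s0 gt_eqF.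
    rewrite sqrrN exprMn (le_trans (ler_piMr _ _)) ?sqr_ge0//.
      rewrite exprn_ile1// ?mulr_expRN_le1// mulr_ge0 ?expR_ge0//.
      by rewrite divr_ge0 ?sqr_ge0// mulr_ge0// ltW.
    rewrite expr_div_n ler_pM2l ?exprn_gt0//; last first.
      by apply: mulr_gt0 => //; apply: mulr_gt0 => //; rewrite exprn_even_gt0.
    rewrite lef_pV2 ?posrE ?exprn_gt0// expr2 ler_peMr ?(ltW a0)//.
    by rewrite /a ler1n.
under eq_integral do rewrite EFinB.
rewrite integralB//=; last first.
  by under eq_fun do rewrite EFinM; exact: integrableZl.
under [X in (_ - X)%E]eq_integral do rewrite EFinM.
rewrite integralZl// integral_normal_pdf mule1 => H.
rewrite -[LHS](@subeK _ _ (s ^+ 2)%:E)// [X in (X + _)%E](_ : _ = 0%E) ?add0e//.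
Qed.

Lemma integrable_id_normal_pdf :
  leb.-integrable setT (fun x => (x * pdf x)%:E).
Proof.
have := integrableD measurableT integrable_sqr_normal_pdf (integrable_normal_pdf 0 s).
apply: le_integrable => //.
  by apply/measurable_EFinP/measurable_funM => //; exact: measurable_normal_pdf.
move=> x _; rewrite lee_fin normrM (le_trans _ (ler_norm _))//.
have p0 := normal_pdf_ge0 0 s x.
rewrite (ger0_norm p0) (_ : _ + _ = (x ^+ 2 + 1) * pdf x); last by ring.
rewrite ler_wpM2r//.
rewrite -(real_normK (num_real x)); have := sqr_ge0 (`|x| - 1).
have := normr_ge0 x; nra.
Qed.

Lemma integral_id_normal_pdf : (\int[leb]_x (x * pdf x)%:E = 0)%E.
Proof.
pose F x := - s ^+ 2 * pdf x.
apply: (@integral0_FTC _ F).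
- by move=> x; apply: cvgM; [exact: cvg_id|exact: continuous_normal_pdf0].
- exact: integrable_id_normal_pdf.
- move=> x; apply: is_derive_eq (is_deriveZ (- s ^+ 2) (is_derive_normal_pdf x)) _.
  by rewrite /GRing.scale/=; field.
- rewrite (_ : (fun _ => _) = cst 0); first exact: cvg_cst.
  by apply/funext => n; rewrite /F !normal_pdf0E sqrrN subrr.
Qed.

End normal_moments.

Section normal_law.
Context {R : realType}.
Variable s : R.
Hypothesis s0 : s != 0.

Lemma L2_id_normal_prob : L2 (normal_prob 0 s) id.
Proof.
split; first exact: measurable_id.
apply/integrableP; split.
  by apply/measurable_EFinP; exact: measurable_funX.
under eq_integral do rewrite gee0_abs ?lee_fin ?sqr_ge0//.
by rewrite integral_sqr_normal_prob// ltry.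
Qed.

Lemma inner_id_normal_prob : inner (normal_prob 0 s) id id = s ^+ 2.
Proof.
apply: EFin_inj; rewrite -(EFin_inner L2_id_normal_prob).
exact: integral_sqr_normal_prob.
Qed.

(* Expanding [(x + 1)^2] turns the mean into an integral of a nonnegative function. *)
Lemma inner1_normal_prob : inner (normal_prob 0 s) (cst 1) id = 0.
Proof.
have L1 : L2 (normal_prob 0 s) (cst 1) := L2_cst _ _.
have Li := L2_id_normal_prob.
have : inner (normal_prob 0 s) (fun x => x - cst (-1) x)
    (fun x => x - cst (-1) x) = s ^+ 2 + 1.
  apply: EFin_inj; rewrite -EFin_inner; last by apply: L2B => //; exact: L2_cst.
  have mf : measurable_fun setT (fun x : R => (x - cst (-1) x) ^+ 2).
    by apply: measurable_funX; exact: measurable_funB.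
  rewrite ge0_integral_normal_prob//; last by move=> x; exact: sqr_ge0.
  have I2 := integrable_sqr_normal_pdf s0.
  have I0 := integrable_normal_pdf 0 s.
  have I1 : (lebesgue_measure : {measure set _ -> \bar R}).-integrable setT
      (fun x : R => (x * normal_pdf 0 s x)%:E).
    exact: integrable_id_normal_pdf.
  under eq_integral => x _.
    rewrite (_ : (_ * _)%:E = ((x ^+ 2 * normal_pdf 0 s x)%:E +
      (2%:E * (x * normal_pdf 0 s x)%:E + (normal_pdf 0 s x)%:E))%E); last first.
      by rewrite -EFinM -!EFinD /cst; congr EFin; ring.
    over.
  rewrite integralD//; last first.
    by apply: integrableD => //; exact: integrableZl.
  rewrite integralD//; last exact: integrableZl.
  rewrite integralZl// integral_id_normal_pdf// integral_normal_pdf mule0 add0e.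
  by rewrite -ge0_integral_normal_prob ?integral_sqr_normal_prob//; move=> x; exact: sqr_ge0.
rewrite inner_sqrB//; last exact: L2_cst.
have cE : inner (normal_prob 0 s) id (cst (-1)) = - inner (normal_prob 0 s) (cst 1) id.
  rewrite -[RHS]mulN1r -innerZr//.
  by apply: eq_Rintegral => x _ /=; ring.
have c1 : inner (normal_prob 0 s) (cst (-1)) (cst (-1)) = 1.
  by rewrite inner_cst mulrNN mulr1.
by rewrite cE c1 inner_id_normal_prob; lra.
Qed.

End normal_law.

(** * Image laws and independence *)

Section image_law.
Context {R : realType} {dO : measure_display} {Omega : measurableType dO}
  {dT : measure_display} {T : measurableType dT}.
Variables (P : probability Omega R) (N : probability T R) (Z : Omega -> T).
Hypotheses (mZ : measurable_fun setT Z)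
  (ZN : forall A, measurable A -> P (Z @^-1` A) = N A).

(** [Z] will be a Brownian increment, a projection of a coupling onto a marginal, or a
    translation. *)
Lemma L2_of_law (f : T -> R) : L2 N f -> L2 P (f \o Z).
Proof.
move=> [mf /integrableP[_ I]].
have mfZ : measurable_fun setT (f \o Z) by exact: measurableT_comp.
split => //; apply/integrableP; split.
  by apply/measurable_EFinP; exact: measurable_funX.
have m2 : measurable_fun setT (fun y => `|(f y ^+ 2)%:E|%E).
  by apply: measurableT_comp => //; apply/measurable_EFinP; exact: measurable_funX.
have := @ge0_integral_pushforward _ _ _ _ R Z mZ P setT _ measurableT m2.
rewrite preimage_setT => <-//.
by rewrite (eq_measure_integral N)// => A mA _; exact: ZN.
Qed.

Lemma inner_of_law (f g : T -> R) : L2 N f -> L2 N g ->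
  inner P (f \o Z) (g \o Z) = inner N f g.
Proof.
move=> Lf Lg; have I1 := L2_integrableM (L2_of_law Lf) (L2_of_law Lg).
rewrite /inner /Rintegral; congr fine.
have m2 : measurable_fun setT (fun y => (f y * g y)%:E).
  by apply/measurable_EFinP; apply: measurable_funM; [exact: Lf.1|exact: Lg.1].
have := @integral_pushforward _ _ _ _ R Z mZ P setT _ m2.
rewrite preimage_setT => /(_ I1 measurableT) /esym.
move=> H; apply: (etrans H).
by apply: (eq_measure_integral N) => A mA _; exact: ZN.
Qed.

End image_law.

Section independence.
Context {R : realType} {dO : measure_display} {Omega : measurableType dO}.
Variable P : probability Omega R.

(** For a fixed [G], the events that factor with [G] form a Dynkin system. *)
Lemma indep_dynkin (C : set (set Omega)) (G : set Omega) :
  setI_closed C -> C `<=` measurable -> measurable G ->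
  (forall A, C A -> P (A `&` G) = (P A * P G)%E) ->
  forall A, <<s C >> A -> P (A `&` G) = (P A * P G)%E.
Proof.
move=> CI Cm mG CG.
have sCm : <<s C >> `<=` measurable by apply: smallest_sub => //; exact: sigma_algebra_measurable.
pose T := g_sigma_algebraType C.
have PGfin : P G = (fine (P G))%:E by rewrite fineK// fin_num_measure.
apply: (@dynkin_induction _ T C (fun A => P (A `&` G) = (P A * P G)%E)) => //.
- by rewrite setTI probability_setT mul1e.
- move=> S /sCm mS SG.
  have PSfin : P S = (fine (P S))%:E by rewrite fineK// fin_num_measure.
  have DE : P (G `\` S) = (P G - P (G `&` S))%E.
    by apply: measureD => //; rewrite ltey_eq fin_num_measure.
  rewrite setIC -setDE DE (setIC G) SG probability_setC// PSfin PGfin.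
  by rewrite -EFinM -!EFinB -EFinM mulrBl mul1r.
- move=> F mF tF FG.
  have mF' n : @measurable _ Omega (F n) by exact: (sCm _ (mF n)).
  have UE : P (\bigcup_k (F k `&` G)) = (\sum_(k <oo) P (F k `&` G))%E.
    apply: measure_semi_bigcup.
    + by move=> n; exact: measurableI.
    + exact: trivIset_setIr.
    + by apply: bigcup_measurable => n _; exact: measurableI.
  have UF : P (\bigcup_k F k) = (\sum_(k <oo) P (F k))%E.
    by apply: measure_semi_bigcup => //; exact: bigcup_measurable.
  rewrite setI_bigcupl UE UF.
  under eq_eseriesr do rewrite FG muleC.
  by rewrite PGfin nneseriesZl// muleC.
Qed.

(** Factorisation on rectangles identifies the law of (V, Z) with the product of the two laws;
    Fubini then integrates the centered variable [Z] first. *)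
Lemma inner_indep (V Z : Omega -> R) : L2 P V -> L2 P Z ->
  (forall A B, measurable A -> measurable B ->
    P ((V @^-1` A) `&` (Z @^-1` B)) = (P (V @^-1` A) * P (Z @^-1` B))%E) ->
  inner P (cst 1) Z = 0 -> inner P V Z = 0.
Proof.
move=> LV LZ VZ Z0.
have mV := LV.1; have mZ := LZ.1.
have mVZ : measurable_fun setT (fun w => (V w, Z w)).
  exact: measurable_fun_pair.
pose mV_ : {RV P >-> R} := HB.pack V (isMeasurableFun.Build _ _ _ _ V mV).
pose mZ_ : {RV P >-> R} := HB.pack Z (isMeasurableFun.Build _ _ _ _ Z mZ).
pose muV : probability R R := distribution P mV_.
pose muZ : probability R R := distribution P mZ_.
pose f (x : R * R) := (x.1 * x.2)%:E.
have mf : measurable_fun setT f.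
  by apply/measurable_EFinP; exact: measurable_funM.
have IVZ := L2_integrableM LV LZ.
have If : (pushforward P (fun w => (V w, Z w))).-integrable setT f.
  exact: integrable_pushforward.
have HU A : measurable A ->
    (muV \x muZ)%E A = pushforward P (fun w => (V w, Z w)) A.
  by apply: product_measure_unique => B1 B2 mB1 mB2; exact: VZ.
have If' : (muV \x muZ)%E.-integrable setT f.
  move/integrableP: If => [_ If]; apply/integrableP; split => //.
  by rewrite (eq_measure_integral (pushforward P (fun w => (V w, Z w))))// => A mA _; exact: HU.
suff : (\int[P]_w (V w * Z w)%:E = 0)%E by rewrite /inner /Rintegral => ->.
have /esym := @integral_pushforward _ _ _ _ R _ mVZ P setT f mf IVZ measurableT.
rewrite preimage_setT => H; apply: (etrans H).
rewrite (eq_measure_integral (muV \x muZ)%E); last by move=> A mA _; exact/esym/HU.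
rewrite -integral12_prod_meas1//.
rewrite (eq_integral (cst 0%E)) ?integral0// => x _.
rewrite /fubini_F /f/=; under eq_integral do rewrite EFinM.
have I1 : muZ.-integrable setT (EFin : R -> \bar R).
  apply: integrable_pushforward => //.
  have := L2_integrableM (L2_cst P 1) LZ.
  by apply: eq_integrable => // w _; rewrite /= mul1r.
rewrite integralZl//.
have -> : (\int[muZ]_y (y%:E) = 0)%E; last by rewrite mule0.
rewrite integral_pushforward//; last first.
  have := L2_integrableM (L2_cst P 1) LZ.
  by apply: eq_integrable => // w _; rewrite /= mul1r.
rewrite preimage_setT; move: Z0; rewrite /inner /Rintegral.
under eq_integral do rewrite /= mul1r.
move=> Z0; rewrite -[LHS]fineK ?Z0//.
apply: integrable_fin_num => //.
have := L2_integrableM (L2_cst P 1) LZ.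
by apply: eq_integrable => // w _; rewrite /= mul1r.
Qed.

End independence.

(** * Filtrations *)

Section generated_sigma_algebras.
Context {dO : measure_display} {Omega : measurableType dO}.

(** Stated on [g_sigma_algebraType F] so that the closure properties of [measurable_fun] (sums,
    products, compositions, pointwise limits) apply to a sub-sigma-algebra. *)
Definition generated_measurable (F : set (set Omega)) {d'} {T : measurableType d'}
    (f : Omega -> T) :=
  @measurable_fun _ _ (g_sigma_algebraType F) T setT f.

Lemma generated_measurableP F {d'} {T : measurableType d'} (f : Omega -> T) :
  generated_measurable F f <-> measurable_wrt <<s F >> f.
Proof.
split=> [mf _ [A mA <-]|mf mT A mA]; first exact: mf.
by apply: mf; exists A.
Qed.

Lemma generated_measurable_preimage F {d'} {T : measurableType d'}
    (f : Omega -> T) A :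
  generated_measurable F f -> measurable A -> <<s F >> (f @^-1` A).
Proof. by move=> mf mA; rewrite -[_ @^-1` _]setTI; exact: mf. Qed.

Lemma g_sigma_setI F (A B : set Omega) :
  <<s F >> A -> <<s F >> B -> <<s F >> (A `&` B).
Proof. exact: (@measurableI _ (g_sigma_algebraType F)). Qed.

Lemma g_sigma_setC F (A : set Omega) : <<s F >> A -> <<s F >> (~` A).
Proof. exact: (@measurableC _ (g_sigma_algebraType F)). Qed.

Lemma g_sigma_setU F (A B : set Omega) :
  <<s F >> A -> <<s F >> B -> <<s F >> (A `|` B).
Proof. exact: (@measurableU _ (g_sigma_algebraType F)). Qed.

Lemma g_sigma_setT F : <<s F >> (@setT Omega).
Proof. exact: (@measurableT _ (g_sigma_algebraType F)). Qed.

Lemma sub_g_sigma (F G : set (set Omega)) : F `<=` <<s G >> -> <<s F >> `<=` <<s G >>.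
Proof. by move=> FG; apply: smallest_sub => //; exact: smallest_sigma_algebra. Qed.

Lemma generated_measurable_sub (F G : set (set Omega)) {d'}
    {T : measurableType d'} (f : Omega -> T) : F `<=` <<s G >> ->
  generated_measurable F f -> generated_measurable G f.
Proof. by move=> /sub_g_sigma FG mf mT A mA; apply: FG; exact: mf. Qed.

Section sigma_of.
Context {d'} {T : measurableType d'} {I : Type} (D : set I) (f : I -> Omega -> T).

Lemma sigma_of_generator i : D i -> measurable_wrt (sigma_of D f) (f i).
Proof. by move=> Di A fA; apply: sub_sigma_algebra; exists i. Qed.

Lemma sigma_of_sub (F : set (set Omega)) :
  (forall i, D i -> measurable_wrt <<s F >> (f i)) -> sigma_of D f `<=` <<s F >>.
Proof. by move=> fF; apply: sub_g_sigma => A [i Di fA]; exact: (fF i Di). Qed.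

Lemma sigma_of_measurable :
  (forall i, D i -> measurable_fun setT (f i)) -> sigma_of D f `<=` measurable.
Proof.
move=> mf; apply: smallest_sub; first exact: sigma_algebra_measurable.
by move=> _ [i Di [A mA <-]]; exact: mf.
Qed.

End sigma_of.

Lemma sigma_of_mono {d'} {T : measurableType d'} {I : Type} (D D' : set I)
    (f : I -> Omega -> T) : D `<=` D' -> sigma_of D f `<=` sigma_of D' f.
Proof. by move=> DD'; apply: sigma_of_sub => i /DD'; exact: sigma_of_generator. Qed.

Context {R : realType} {d : nat}.

Lemma generated_measurable_tnth F (f : Omega -> d.-tuple R) i :
  generated_measurable F f -> generated_measurable F (fun w => tnth (f w) i).
Proof. by move=> /measurable_fun_tnthP/(_ i). Qed.

Lemma generated_measurable_tuple F (f : Omega -> d.-tuple R) :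
  (forall i, generated_measurable F (fun w => tnth (f w) i)) ->
  generated_measurable F f.
Proof. by move=> mf; apply/measurable_fun_tnthP. Qed.

End generated_sigma_algebras.

(** * The augmented past and its independence from later noise *)

Section augmented_filtration.
Context {R : realType} {d : nat} {dO : measure_display} {Omega : measurableType dO}.
Variable P : probability Omega R.
Local Notation Rd := (d.-tuple R).
Variables (k : nat) (sigma : R) (X : nat -> R -> Omega -> Rd) (B : R -> Omega -> Rd).
Hypothesis XB : integrated_white_noise P k sigma X B.

Local Notation jet := (sigma_of [set j | (j <= k)%N] (fun j => X j 0)).
Local Notation noise s := (sigma_of `[0, s] B).

(* A pi-system generating the augmentation of the sigma-algebra of the initial
   jet and of the noise up to time [s]; the almost sure events [E] absorb the
   null set off which x^(k) = x^(k)(0) + sigma B. *)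
Definition observed_pi (s : R) : set (set Omega) :=
  [set A | exists J C E, [/\ jet J, noise s C, measurable E, P E = 1%E &
                             A = J `&` C `&` E]].

Let jet_measurable : jet `<=` measurable.
Proof. by apply: sigma_of_measurable => j jk; exact: (iwn_measurable XB). Qed.

Let noise_measurable s : noise s `<=` measurable.
Proof.
apply: sigma_of_measurable => t /=; rewrite in_itv/= => /andP[t0 _].
exact: (brownian_measurable (iwn_brownian XB)).
Qed.

Let full_setI (A E : set Omega) : measurable A -> measurable E -> P E = 1%E ->
  P (A `&` E) = P A.
Proof.
move=> mA mE PE.
have nE : P (~` E) = 0%E by rewrite probability_setC// PE subee.
apply/eqP; rewrite eq_le; apply/andP; split.
  by apply: le_measure; rewrite ?inE//; exact: measurableI.
have -> : P A = (P (A `\` E) + P (A `&` E))%E by exact: measureDI.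
rewrite (_ : P (A `\` E) = 0%E) ?add0e//.
apply/eqP; rewrite eq_le measure_ge0 andbT -nE.
apply: le_measure; rewrite ?inE//; [exact: measurableD|exact: measurableC].
Qed.

Lemma observed_pi_setI s : setI_closed (observed_pi s).
Proof.
move=> _ _ [J [C [E [jJ nC mE PE ->]]]] [J' [C' [E' [jJ' nC' mE' PE' ->]]]].
exists (J `&` J'), (C `&` C'), (E `&` E'); split.
- exact: g_sigma_setI.
- exact: g_sigma_setI.
- exact: measurableI.
- by rewrite full_setI.
- by rewrite (setIACA _ E) (setIACA J).
Qed.

Lemma observed_pi_measurable s : observed_pi s `<=` measurable.
Proof.
move=> _ [J [C [E [jJ nC mE PE ->]]]].
apply: measurableI => //; apply: measurableI; first exact: jet_measurable.
exact: noise_measurable nC.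
Qed.

Lemma jet_observed s : jet `<=` <<s observed_pi s >>.
Proof.
move=> J jJ; apply: sub_sigma_algebra; exists J, setT, setT.
by rewrite !setIT; split => //; [exact: g_sigma_setT|exact: probability_setT].
Qed.

Lemma noise_observed s : noise s `<=` <<s observed_pi s >>.
Proof.
move=> C nC; apply: sub_sigma_algebra; exists setT, C, setT.
by rewrite setIT setTI; split => //; [exact: g_sigma_setT|exact: probability_setT].
Qed.

Lemma null_observed s N : measurable N -> P N = 0%E -> <<s observed_pi s >> N.
Proof.
move=> mN PN; rewrite -(setCK N); apply: g_sigma_setC.
apply: sub_sigma_algebra; exists setT, setT, (~` N); split.
- exact: g_sigma_setT.
- exact: g_sigma_setT.
- exact: measurableC.
- by rewrite probability_setC// PN sube0.
- by rewrite !setTI.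
Qed.

(** Off a null set the preimages under [V] and [W] coincide. Inside it, measurability of [V] makes
    the remaining piece a measurable null event, which is observed; P is not assumed complete. *)
Lemma observed_ae s (V W : Omega -> R) : measurable_fun setT V ->
  generated_measurable (observed_pi s) W -> {ae P, forall w, V w = W w} ->
  generated_measurable (observed_pi s) V.
Proof.
move=> mV mW [N [mN PN VW]] _ A mA; rewrite setTI.
rewrite (_ : _ @^-1` _ = (W @^-1` A `&` ~` N) `|` (V @^-1` A `&` N)).
  apply: g_sigma_setU.
    apply: g_sigma_setI; first exact: generated_measurable_preimage.
    by apply: g_sigma_setC; exact: null_observed.
  have mVA : measurable (V @^-1` A) by rewrite -[_ @^-1` _]setTI; exact: mV.
  apply: null_observed; first exact: measurableI.
  apply/eqP; rewrite eq_le measure_ge0 andbT -PN.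
  by apply: le_measure; rewrite ?inE//; exact: measurableI.
have VWN w : ~ N w -> V w = W w.
  by move=> nN; apply: contrapT => nVW; apply: nN; exact: VW.
apply/seteqP; split => w /=.
  by have [Nw|nN] := pselect (N w); [right|left; rewrite -VWN].
by move=> [[+ nN]|[]//]; rewrite -VWN.
Qed.

Lemma observed_mono (s t : R) : s <= t ->
  <<s observed_pi s >> `<=` <<s observed_pi t >>.
Proof.
move=> st; apply: sub_g_sigma => _ [J [C [E [jJ nC mE PE ->]]]].
apply: sub_sigma_algebra; exists J, C, E; split => //.
apply: sigma_of_mono nC => u /=; rewrite !in_itv/= => /andP[-> us].
exact: le_trans us st.
Qed.

(** On a generating set J, C, E: the almost sure event E drops out; J is independent of all the
    noise, hence of C together with the increment; C is independent of the increment alone. *)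
Lemma observed_indep_increment (s t : R) A G : 0 <= s -> s < t ->
  <<s observed_pi s >> A ->
  sigma_of [set: unit] (fun _ w => vsub (B t w) (B s w)) G ->
  P (A `&` G) = (P A * P G)%E.
Proof.
move=> s0 st sA sG; have WB := iwn_brownian XB.
have t0 : 0 <= t by rewrite ltW// (le_lt_trans s0).
pose N := \bigcup_(u in `[0, +oo[%classic) preimage_set_system setT (B u) measurable.
have GN : <<s N >> G.
  apply: (sigma_of_sub _ sG) => _ _; apply/generated_measurableP.
  apply: generated_measurable_tuple => i.
  rewrite (_ : (fun _ => _) = (fun w => tnth (B t w) i - tnth (B s w) i)).
    apply: measurable_funB; apply: generated_measurable_tnth;
      apply/generated_measurableP; apply: sigma_of_generator;
      by rewrite /= in_itv/= andbT.
  by apply/funext => w; rewrite tnth_mktuple.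
have mN : <<s N >> `<=` measurable.
  apply: sigma_of_measurable => u /=; rewrite in_itv/= andbT.
  exact: (brownian_measurable WB).
have mG : measurable G by exact: mN.
apply: (indep_dynkin (@observed_pi_setI s) (@observed_pi_measurable s) mG _ sA).
move=> _ [J [C [E [jJ nC mE PE ->]]]].
have CN : <<s N >> C.
  by apply: sigma_of_mono nC => u /=; rewrite !in_itv/= => /andP[->].
have mJ := jet_measurable jJ; have mC := noise_measurable nC.
rewrite setIAC full_setI//; last by do 2 apply: measurableI => //.
rewrite [in RHS]full_setI//; last exact: measurableI.
rewrite -setIA (iwn_indep XB jJ (g_sigma_setI CN GN)).
rewrite (iwn_indep XB jJ CN) (brownian_indep_increments WB s0 st nC sG).
by rewrite muleA.
Qed.

Lemma observed_jet0 s j i : (j <= k)%N ->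
  generated_measurable (observed_pi s) (fun w => tnth (X j 0 w) i).
Proof.
move=> jk; apply: generated_measurable_tnth; apply/generated_measurableP.
by move=> A XA; apply: jet_observed; exact: (@sigma_of_generator _ _ _ _ _ _ _ j jk).
Qed.

(** Downward induction on j. The top derivative is almost surely jet plus noise; a lower one at u is
    its value at 0 plus a limit of Riemann sums of the next derivative, sampled at times at most
    u. *)
Lemma observed_derivative (s u : R) i j : (j <= k)%N -> 0 <= u -> u <= s ->
  generated_measurable (observed_pi s) (fun w => tnth (X j u w) i).
Proof.
move=> jk u0 us.
have [m mkj] : exists m, (k - j = m)%N by exists (k - j)%N.
elim: m j jk mkj u u0 us => [|m IHm] j jk mkj u u0 us.
  have -> : j = k by apply/eqP; rewrite eqn_leq jk -subn_eq0 mkj.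
  apply: (@observed_ae _ _ (fun w => tnth (X k 0 w) i + sigma * tnth (B u w) i)).
  - by have /measurable_fun_tnthP/(_ i) := iwn_measurable XB (leqnn k) u0.
  - apply: measurable_funD; first exact: observed_jet0.
    apply: measurable_funM => //; apply: generated_measurable_tnth.
    apply/generated_measurableP => A BA; apply: (@noise_observed s).
    by apply: (@sigma_of_generator _ _ _ _ _ _ _ u) => //=; rewrite in_itv/= u0.
  - by apply: filterS (iwn_noise XB) => w; exact.
have jk' : (j < k)%N by rewrite -subn_gt0 mkj.
have mkj' : (k - j.+1 = m)%N by rewrite subnS mkj.
apply: (@measurable_fun_cvg _ (g_sigma_algebraType (observed_pi s)) _ setT
  (fun n w => tnth (X j 0 w) i + \sum_(l < n.+1)
    tnth (X j.+1 (0 + l%:R * (u / n.+1%:R)) w) i * (u / n.+1%:R))).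
  move=> n; apply: measurable_funD; first exact: observed_jet0.
  apply: measurable_sum => l; apply: measurable_funM => //.
  have un0 : 0 <= u / n.+1%:R by exact: divr_ge0.
  apply: IHm => //.
    by rewrite add0r mulr_ge0.
  rewrite add0r (le_trans _ us)// mulrA ler_pdivrMr ?ltr0n// mulrC.
  by rewrite ler_wpM2l// ler_nat ltnW.
move=> w _.
have H := @cvg_riemann_sum R (fun v => tnth (X j v w) i)
  (fun v => tnth (X j.+1 v w) i) 0 u (lexx _) u0.
have -> : tnth (X j u w) i =
    tnth (X j 0 w) i + (tnth (X j (0 + u) w) i - tnth (X j 0 w) i).
  by rewrite add0r addrC subrK.
apply: cvgD; first exact: cvg_cst.
apply: H.
- exact: (@iwn_continuous _ _ _ _ _ _ _ _ _ XB j w jk i).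
- exact: (@iwn_continuous _ _ _ _ _ _ _ _ _ XB j.+1 w jk' i).
- by move=> v v0; exact: (iwn_derive XB).
Qed.

End augmented_filtration.

(** * Taylor expansions and the prediction error *)

Section taylor_polynomials.
Context {R : realType}.
Implicit Types (a : nat -> R) (t v : R).

Lemma is_derive_taylor n a t v :
  is_derive v 1 (fun u : R => \sum_(m < n.+1) (u - t) ^+ m / m`!%:R * a m)
    (\sum_(m < n) (v - t) ^+ m / m`!%:R * a m.+1).
Proof.
have mono m : is_derive v 1 (fun u : R => (u - t) ^+ m.+1 / m.+1`!%:R * a m.+1)
    ((v - t) ^+ m / m`!%:R * a m.+1).
  rewrite (_ : (fun u => _) = (a m.+1 / m.+1`!%:R) *: ((id : R -> R) - cst t) ^+ m.+1);
    last by apply/funext => u; rewrite !fctE /GRing.scale/=; ring.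
  apply: is_derive_eq; rewrite /GRing.scale/= factS natrM !fctE subr0 mulr1.
  have f0 : m`!%:R != 0 :> R by rewrite pnatr_eq0 -lt0n fact_gt0.
  by field; rewrite f0 addrC natr1 pnatr_eq0.
rewrite (_ : (fun u => _) = cst (a 0) +
    \sum_(m < n) (fun u : R => (u - t) ^+ m.+1 / m.+1`!%:R * a m.+1)); last first.
  apply/funext => u; rewrite big_ord_recl/= expr0 fact0 divr1 mul1r.
  by rewrite !fctE fct_sumE.
rewrite -[X in is_derive _ _ _ X]add0r.
by apply: is_deriveD; apply: is_derive_sum => m; exact: mono.
Qed.

Lemma continuous_taylor n a t :
  continuous (fun u : R => \sum_(m < n) (u - t) ^+ m / m`!%:R * a m).
Proof.
case: n => [|n] v.
  by rewrite (_ : (fun _ => _) = cst 0); [exact: cvg_cst|apply/funext => u; rewrite big_ord0].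
by apply: differentiable_continuous; apply/derivable1_diffP; have [] := is_derive_taylor n a t v.
Qed.

(** Change of base point: the polynomial with derivatives [x p] at 0 is evaluated at a + dl through
    its derivatives at dl. Raising n by one adds the terms in [x n.+1], and these match by the
    binomial theorem. *)
Lemma taylor_shift n (a : R) (x : nat -> R) (dl : R) :
  \sum_(l < n.+1) a ^+ l / l`!%:R *
     \sum_(m < (n - l).+1) dl ^+ m / m`!%:R * x (l + m)%N =
  \sum_(p < n.+1) (a + dl) ^+ p / p`!%:R * x p.
Proof.
elim: n => [|n IHn].
  by rewrite big_ord1 [RHS]big_ord1/= subn0 big_ord1/= addn0 !expr0 fact0; field.
rewrite [RHS]big_ord_recr/= -IHn big_ord_recr/= subnn big_ord1 addn0.
have -> : \sum_(l < n.+1) a ^+ l / l`!%:R *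
     \sum_(m < (n.+1 - l).+1) dl ^+ m / m`!%:R * x (l + m)%N =
  \sum_(l < n.+1) a ^+ l / l`!%:R *
     (\sum_(m < (n - l).+1) dl ^+ m / m`!%:R * x (l + m)%N) +
  \sum_(l < n.+1) a ^+ l / l`!%:R * (dl ^+ (n.+1 - l) / (n.+1 - l)`!%:R * x n.+1).
  rewrite -big_split/=; apply: eq_bigr => l _.
  have ln : (l <= n)%N by rewrite -ltnS.
  rewrite (subSn ln) big_ord_recr/= mulrDr; congr (_ + _ * (_ * x _)).
  by rewrite addnS subnKC.
rewrite -addrA; congr (_ + _).
have term l : (l <= n.+1)%N ->
    a ^+ l / l`!%:R * (dl ^+ (n.+1 - l) / (n.+1 - l)`!%:R * x n.+1) =
    (dl ^+ (n.+1 - l) * a ^+ l *+ 'C(n.+1, l)) / n.+1`!%:R * x n.+1.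
  move=> ln; rewrite -(bin_fact ln) !natrM -mulr_natr; field.
  by rewrite !pnatr_eq0 -!lt0n !fact_gt0 bin_gt0.
rewrite [a + dl]addrC exprDn 2!mulr_suml [RHS]big_ord_recr/= -term// subnn.
by congr (_ + _); apply: eq_bigr => l _; apply: term; rewrite ltnW.
Qed.

End taylor_polynomials.

Section square_integrable_sums.
Context {R : realType} {dO : measure_display} {Omega : measurableType dO}.
Variable P : probability Omega R.

Lemma inner_le f g (M : R) : L2 P f -> L2 P g -> inner P f f <= M ->
  inner P g g <= M -> inner P f g <= M.
Proof.
move=> Lf Lg fM gM; have M0 : 0 <= M by rewrite (le_trans (inner_ge0 P f)).
have := cauchy_schwarz_inner Lf Lg.
have := inner_ge0 P f; have := inner_ge0 P g; nra.
Qed.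

Lemma inner_sum_sum n (F : 'I_n -> Omega -> R) : (forall l, L2 P (F l)) ->
  inner P (fun w => \sum_(l < n) F l w) (fun w => \sum_(l < n) F l w) =
  \sum_(l < n) \sum_(l' < n) inner P (F l) (F l').
Proof.
move=> LF; rewrite inner_sumr//; last exact: L2_sum.
by apply: eq_bigr => l _; rewrite innerC inner_sumr.
Qed.

(** The crude factor n^2 presumes no orthogonality. It is affordable for remainders of order l < k,
    whose second moments are of order c^3 with c of order 1/n. *)
Lemma inner_sum_le n (F : 'I_n -> Omega -> R) (M : R) : (forall l, L2 P (F l)) ->
  (forall l, inner P (F l) (F l) <= M) ->
  inner P (fun w => \sum_(l < n) F l w) (fun w => \sum_(l < n) F l w) <=
  n%:R ^+ 2 * M.
Proof.
move=> LF FM; rewrite inner_sum_sum//.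
rewrite (_ : n%:R ^+ 2 * M = \sum_(l < n) \sum_(l' < n) M); last first.
  by rewrite !sumr_const card_ord -[RHS]mulr_natl -[M *+ n]mulr_natl; ring.
by do 2 (apply: ler_sum => ? _); apply: inner_le.
Qed.

Lemma inner_ae V f g : measurable_fun setT f -> L2 P V -> L2 P g ->
  {ae P, forall w, f w = g w} -> inner P V f = inner P V g.
Proof.
move=> mf LV Lg fg; rewrite /inner /Rintegral; congr fine.
apply: ae_eq_integral => //.
- by apply/measurable_EFinP/measurable_funM => //; exact: LV.1.
- by apply/measurable_EFinP/measurable_funM => //; [exact: LV.1|exact: Lg.1].
- by apply: filterS fg => w /= -> _.
Qed.

End square_integrable_sums.

Section prediction_error.
Context {R : realType} {d : nat} {dO : measure_display} {Omega : measurableType dO}.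
Variable P : probability Omega R.
Local Notation Rd := (d.-tuple R).
Variables (k : nat) (sigma : R) (X : nat -> R -> Omega -> Rd) (B : R -> Omega -> Rd).
Hypothesis XB : integrated_white_noise P k sigma X B.
Variable i : 'I_d.

Local Notation x j t := (fun w => tnth (X j t w) i).

Let increment (s t : R) (w : Omega) : R := tnth (B t w) i - tnth (B s w) i.

Let increment_measurable (s t : R) : 0 <= s -> 0 <= t ->
  measurable_fun setT (increment s t).
Proof.
move=> s0 t0; have mB := brownian_measurable (iwn_brownian XB).
by apply: measurable_funB;
  [have /measurable_fun_tnthP/(_ i) := mB t t0|have /measurable_fun_tnthP/(_ i) := mB s s0].
Qed.

Let increment_law (s t : R) : 0 <= s -> s < t ->
  forall A, measurable A ->
  P (increment s t @^-1` A) = normal_prob 0 (Num.sqrt (t - s)) A.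
Proof.
move=> s0 st A mA.
have H := brownian_gaussian_increments (iwn_brownian XB) s0 st.
have {}H := H (fun j => if j == i then A else setT) _.
have -> : increment s t @^-1` A = [set w | forall j,
    (if j == i then A else setT) (tnth (vsub (B t w) (B s w)) j)].
  apply/seteqP; split => w /=.
    by move=> Aw j; case: eqP => // ->; rewrite tnth_mktuple.
  by move=> /(_ i); rewrite eqxx tnth_mktuple.
rewrite H; last by move=> j; case: eqP.
rewrite (bigD1 i)//= eqxx big1 ?mule1// => j /negPf ->.
exact: (probability_setT (normal_prob 0 (Num.sqrt (t - s)))).
Qed.

Let increment_L2 (s t : R) : 0 <= s -> s <= t ->
  [/\ L2 P (increment s t), inner P (increment s t) (increment s t) = t - s &
      inner P (cst 1) (increment s t) = 0].
Proof.
move=> s0; rewrite le_eqVlt => /orP[/eqP <-|st].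
  (* The normal law is used only with nonzero deviation, so the empty increment is treated apart. *)
  have -> : increment s s = cst 0 by apply/funext => w; rewrite /increment subrr.
  by rewrite !inner_cst !mulr0 subrr; split => //; exact: L2_cst.
have t0 : 0 <= t by rewrite ltW// (le_lt_trans s0).
have mI := increment_measurable s0 t0.
have st0 : Num.sqrt (t - s) != 0 by rewrite gt_eqF// sqrtr_gt0 subr_gt0.
pose N : probability (measurableTypeR R) R := normal_prob 0 (Num.sqrt (t - s)).
have LN : L2 N id := L2_id_normal_prob st0.
have law A : measurable A -> P (increment s t @^-1` A) = N A.
  exact: increment_law.
split.
- exact: (@L2_of_law R dO Omega _ (measurableTypeR R) P N (increment s t) mI law id LN).
- have -> := @inner_of_law R dO Omega _ (measurableTypeR R) P N (increment s t) mI law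
    id id LN LN; rewrite inner_id_normal_prob//.
  by rewrite sqr_sqrtr// subr_ge0 ltW.
- by have -> := @inner_of_law R dO Omega _ (measurableTypeR R) P N (increment s t) mI law
    (cst 1) id (L2_cst N 1) LN; rewrite inner1_normal_prob.
Qed.

Let increment_orthogonal (s t : R) (V : Omega -> R) : 0 <= s -> s <= t -> L2 P V ->
  generated_measurable (observed_pi P k X B s) V ->
  inner P V (increment s t) = 0.
Proof.
move=> s0 st LV mV; have [LI _ I0] := increment_L2 s0 st.
move: st; rewrite le_eqVlt => /orP[/eqP st|st].
  have -> : increment s t = cst 0.
    by apply/funext => w; rewrite /increment st subrr.
  rewrite /inner (eq_Rintegral _ (g := cst 0)) ?Rintegral_cst// ?mul0r// => w _.
  by rewrite mulr0.
apply: inner_indep => // A C mA mC.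
apply: (observed_indep_increment XB s0 st).
  exact: generated_measurable_preimage.
have mI : measurable_wrt (sigma_of [set: unit] (fun _ w => vsub (B t w) (B s w)))
    (increment s t).
  apply/generated_measurableP.
  rewrite (_ : increment s t = fun w => tnth (vsub (B t w) (B s w)) i).
    apply: generated_measurable_tnth; apply/generated_measurableP.
    exact: (@sigma_of_generator _ _ _ _ _ _ _ tt).
  by apply/funext => w; rewrite tnth_mktuple.
by apply: mI; exists C => //; rewrite setTI.
Qed.

(** The expansion of x^(j) stops at order k - j, so that it uses exactly the derivatives up to
    x^(k); for j = k the remainder is an increment of x^(k). *)
Definition taylor_remainder (j : nat) (t dl : R) (w : Omega) : R :=
  tnth (X j (t + dl) w) i -
  \sum_(m < (k - j).+1) dl ^+ m / m`!%:R * tnth (X (j + m)%N t w) i.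

Let x_measurable j (t : R) : (j <= k)%N -> 0 <= t -> measurable_fun setT (x j t).
Proof.
by move=> jk t0; have /measurable_fun_tnthP/(_ i) := iwn_measurable XB jk t0.
Qed.

Lemma taylor_remainder_measurable j (t dl : R) : (j <= k)%N -> 0 <= t -> 0 <= dl ->
  measurable_fun setT (taylor_remainder j t dl).
Proof.
move=> jk t0 dl0; apply: measurable_funB.
  by apply: x_measurable => //; exact: addr_ge0.
apply: measurable_sum => m; apply: measurable_funM => //.
apply: x_measurable => //; have mk : (m <= k - j)%N by rewrite -ltnS.
by rewrite (leq_trans (leq_add (leqnn j) mk))// subnKC.
Qed.

Lemma taylor_remainder_noise (t dl : R) : 0 <= t -> 0 <= dl ->
  {ae P, forall w, taylor_remainder k t dl w = sigma * increment t (t + dl) w}.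
Proof.
move=> t0 dl0; apply: filterS (iwn_noise XB) => w nw.
rewrite /taylor_remainder subnn big_ord1 expr0 fact0 divr1 mul1r addn0.
by rewrite (nw _ i (addr_ge0 t0 dl0)) (nw t i t0) /increment; ring.
Qed.

(** Along each path the remainder of order j is the integral over [0, dl] of the remainder of order
    j + 1, so each step down in j gains a factor dl^2 in second moment: n + 1 summands of step c =
    dl / (n + 1) cost ((n + 1) c)^2. The constant is not sharp; for j < k only the power of dl
    matters. *)
Lemma taylor_remainder_bound j (t dl : R) : (j <= k)%N -> 0 <= t -> 0 <= dl ->
  L2 P (taylor_remainder j t dl) /\
  inner P (taylor_remainder j t dl) (taylor_remainder j t dl) <=
    sigma ^+ 2 * dl ^+ (2 * (k - j)).+1.
Proof.
move=> jk t0; have [m mkj] : exists m, (k - j = m)%N by exists (k - j)%N.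
elim: m j jk mkj dl => [|m IHm] j jk mkj dl dl0; rewrite mkj.
  have -> : j = k by apply/eqP; rewrite eqn_leq jk -subn_eq0 mkj.
  have tdl : t <= t + dl by rewrite lerDl.
  have [LI II _] := increment_L2 t0 tdl.
  have mr := taylor_remainder_measurable (leqnn k) t0 dl0.
  have rae := taylor_remainder_noise t0 dl0.
  have LsI := L2Z sigma LI.
  have Lr := L2_ae mr LsI rae; split => //.
  rewrite (inner_ae mr Lr LsI rae) innerC (inner_ae mr LsI LsI rae).
  rewrite innerZr// innerC innerZr// II expr1; nra.
have jk' : (j < k)%N by rewrite -subn_gt0 mkj.
have mkj' : (k - j.+1 = m)%N by rewrite subnS mkj.
pose S n w := \sum_(l < n.+1)
  (dl / n.+1%:R) * taylor_remainder j.+1 t (l%:R * (dl / n.+1%:R)) w.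
have cn n : 0 <= dl / n.+1%:R by exact: divr_ge0.
have LF n l : L2 P (fun w => (dl / n.+1%:R) *
    taylor_remainder j.+1 t (l%:R * (dl / n.+1%:R)) w).
  by apply: L2Z; apply: (IHm j.+1 jk' mkj' _ _).1; exact: mulr_ge0.
apply: (@L2_fatou _ _ _ P S).
- by move=> n; apply: L2_sum => l _; exact: (LF n l).
- move=> n; set c := dl / n.+1%:R; have c0 : 0 <= c := cn n.
  apply: (le_trans (@inner_sum_le _ _ _ P n.+1 _
    (c ^+ 2 * (sigma ^+ 2 * dl ^+ (2 * m).+1)) (fun l : 'I_n.+1 => LF n l) _)).
    move=> l; have lc : 0 <= l%:R * c by exact: mulr_ge0.
    have [Lr rb] := IHm j.+1 jk' mkj' _ lc.
    rewrite (innerZr c (L2Z c Lr) Lr) innerC (innerZr c Lr Lr) mulrA -expr2.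
    rewrite ler_wpM2l ?sqr_ge0// (le_trans rb)//.
    rewrite mkj' ler_wpM2l ?sqr_ge0// lerXn2r ?nnegrE//.
    by rewrite /c mulrA ler_pdivrMr ?ltr0n// mulrC ler_wpM2l// ler_nat ltnW// ltn_ord.
  rewrite mulrA -exprMn /c (mulrC dl) mulVKf ?pnatr_eq0//.
  by rewrite mulnS addSn add1n !exprS; lra.
move=> w.
(* [f] is the remainder as a function of the endpoint, [g] its derivative, which is the remainder
   one order up. *)
pose f v := tnth (X j v w) i -
  \sum_(p < (k - j).+1) (v - t) ^+ p / p`!%:R * tnth (X (j + p)%N t w) i.
pose g v := tnth (X j.+1 v w) i -
  \sum_(p < (k - j.+1).+1) (v - t) ^+ p / p`!%:R * tnth (X (j.+1 + p)%N t w) i.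
have ft : f t = 0.
  rewrite /f big_ord_recl big1.
    by rewrite /= expr0 fact0 divr1 mul1r addn0 addr0 subrr.
  by move=> p _; rewrite subrr expr0n/= mul0r mul0r.
rewrite (_ : taylor_remainder j t dl w = f (t + dl) - f t); last first.
  by rewrite ft subr0 /taylor_remainder /f (addrC t) addrK.
rewrite (_ : S ^~ w = (fun n => \sum_(l < n.+1)
    g (t + l%:R * (dl / n.+1%:R)) * (dl / n.+1%:R))); last first.
  apply/funext => n; apply: eq_bigr => l _; rewrite mulrC; congr (_ * _).
  by rewrite /taylor_remainder /g [t + _ - t]addrAC subrr add0r.
have contsub (q : nat) (F : R -> R) : (q <= k)%N -> continuous F ->
    {within `[0, +oo[, continuous (fun v => tnth (X q v w) i - F v)}.
  move=> qk cF v.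
  apply: cvgB; first exact: (@iwn_continuous _ _ _ _ _ _ _ _ _ XB q w qk i v).
  by apply: continuous_subspaceT.
apply: cvg_riemann_sum => //.
- by apply: contsub => //; exact: (@continuous_taylor R _ (fun p => tnth (X (j + p)%N t w) i)).
- by apply: contsub => //; exact: (@continuous_taylor R _ (fun p => tnth (X (j.+1 + p)%N t w) i)).
move=> s s0; apply: is_deriveB; first exact: (iwn_derive XB).
have kj : (k - j = (k - j.+1).+1)%N by rewrite -subSn// subSS.
rewrite kj; under eq_bigr do rewrite addSnnS.
exact: (@is_derive_taylor R _ (fun p => tnth (X (j + p)%N t w) i)).
Qed.

Lemma inner_taylor_remainder_noise (t dl : R) : 0 <= t -> 0 <= dl ->
  inner P (taylor_remainder k t dl) (taylor_remainder k t dl) = sigma ^+ 2 * dl.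
Proof.
move=> t0 dl0; have tdl : t <= t + dl by rewrite lerDl.
have [LI II _] := increment_L2 t0 tdl.
have [Lr _] := taylor_remainder_bound (leqnn k) t0 dl0.
have rae := taylor_remainder_noise t0 dl0; have LsI := L2Z sigma LI.
rewrite (inner_ae Lr.1 Lr LsI rae) innerC (inner_ae Lr.1 LsI LsI rae).
rewrite (innerZr _ LsI LI) innerC (innerZr _ LI LI) II; ring.
Qed.

Lemma taylor_remainder_orthogonal (s t dl : R) (V : Omega -> R) :
  0 <= s -> s <= t -> 0 <= dl -> L2 P V ->
  generated_measurable (observed_pi P k X B s) V ->
  inner P V (taylor_remainder k t dl) = 0.
Proof.
move=> s0 st dl0 LV mV; have t0 := le_trans s0 st.
have tdl : t <= t + dl by rewrite lerDl.
have [LI _ _] := increment_L2 t0 tdl.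
have [Lr _] := taylor_remainder_bound (leqnn k) t0 dl0.
rewrite (inner_ae Lr.1 LV (L2Z sigma LI) (taylor_remainder_noise t0 dl0)).
rewrite innerZr// increment_orthogonal ?mulr0//.
apply: (generated_measurable_sub _ mV) => A pA.
by apply: (observed_mono st); exact: sub_sigma_algebra.
Qed.

Lemma taylor_remainder_observed (s t dl : R) : 0 <= t -> 0 <= dl -> t + dl <= s ->
  generated_measurable (observed_pi P k X B s) (taylor_remainder k t dl).
Proof.
move=> t0 dl0 ts; apply: measurable_funB.
  by apply: (observed_derivative XB) => //; exact: addr_ge0.
apply: measurable_sum => m; apply: measurable_funM => //.
have m0 : (m : nat) = 0%N.
  by apply/eqP; rewrite -leqn0 -[X in (_ <= X)%N](subnn k) -ltnS; exact: ltn_ord.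
rewrite m0 addn0; apply: (observed_derivative XB) => //.
by rewrite (le_trans _ ts)// lerDl.
Qed.

Lemma taylor_telescope (T t dl : R) (w : Omega) :
  \sum_(l < k.+1) (T - (t + dl)) ^+ l / l`!%:R * tnth (X l (t + dl) w) i -
  \sum_(l < k.+1) (T - t) ^+ l / l`!%:R * tnth (X l t w) i =
  \sum_(l < k.+1) (T - (t + dl)) ^+ l / l`!%:R * taylor_remainder l t dl w.
Proof.
have -> : T - t = T - (t + dl) + dl by ring.
rewrite -(taylor_shift k _ (fun l => tnth (X l t w) i)) -sumrB.
by apply: eq_bigr => l _; rewrite -mulrBr.
Qed.

(** * Subdivision of the forecast interval *)

Section horizon.
Variables (h tn : R).
Hypotheses (h0 : 0 < h) (tn0 : 0 <= tn).

Definition prediction_error (w : Omega) : R :=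
  tnth (X 0%N (tn + h) w) i - tnth (taylor k h tn X w) i.

Let step n : R := h / n.+1%:R.
Let time n p : R := tn + p%:R * step n.
(** The factor (T - t)^l / l! at the right endpoint of the p-th subinterval, hence [p.+1]:
    [taylor_telescope] expands there. *)
Let weight n p l : R := (h - p.+1%:R * step n) ^+ l / l`!%:R.

Let main_part n w : R :=
  \sum_(p < n.+1) weight n p k * taylor_remainder k (time n p) (step n) w.
Let small_part n w : R := \sum_(p < n.+1) \sum_(l < k)
  weight n p l * taylor_remainder l (time n p) (step n) w.

Let step_gt0 n : 0 < step n. Proof. exact: divr_gt0. Qed.
Let time_ge n p : tn <= time n p.
Proof. by rewrite lerDl mulr_ge0// ltW. Qed.
Let time_ge0 n p : 0 <= time n p. Proof. exact: le_trans (time_ge n p). Qed.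
Let timeS n p : time n p.+1 = time n p + step n.
Proof. by rewrite /time -natr1; ring. Qed.
Let nstep n : n.+1%:R * step n = h.
Proof. by rewrite /step mulrC divfK// pnatr_eq0. Qed.

Let error_decomposition n w : prediction_error w = main_part n w + small_part n w.
Proof.
pose Q t := \sum_(l < k.+1) (tn + h - t) ^+ l / l`!%:R * tnth (X l t w) i.
have -> : prediction_error w = Q (time n n.+1) - Q (time n 0).
  rewrite /time nstep mul0r addr0 /Q /prediction_error /taylor tnth_mktuple.
  congr (_ - _); last by apply: eq_bigr => l _; rewrite [tn + h]addrC addrK.
  rewrite big_ord_recl big1 ?addr0 => [|l _]; last by rewrite subrr expr0n/= !mul0r.
  by rewrite expr0 fact0 divr1 mul1r.
rewrite -(telescope_sumr (fun p => Q (time n p)))// big_mkord -big_split/=.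
apply: eq_bigr => p _; rewrite timeS /Q taylor_telescope big_ord_recr/= addrC.
rewrite -timeS (_ : tn + h - time n p.+1 = h - p.+1%:R * step n)//.
by rewrite /time; ring.
Qed.

Let main_L2 n : L2 P (main_part n).
Proof.
apply: L2_sum => p _; apply: L2Z.
exact: (taylor_remainder_bound (leqnn k) (time_ge0 n p) (ltW (step_gt0 n))).1.
Qed.

Let remainder_L2 n p (l : 'I_k) :
  L2 P (fun w => weight n p l * taylor_remainder l (time n p) (step n) w).
Proof.
apply: L2Z.
exact: (taylor_remainder_bound (ltnW (ltn_ord l)) (time_ge0 n p) (ltW (step_gt0 n))).1.
Qed.

Lemma prediction_error_L2 : L2 P prediction_error.
Proof.
rewrite (_ : prediction_error = fun w => main_part 0 w + small_part 0 w).
  apply: L2D; first exact: main_L2.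
  by apply: L2_sum => p _; apply: L2_sum => l _; exact: remainder_L2.
by apply/funext => w; exact: error_decomposition.
Qed.

(** Base 1 + h instead of h, so that powers grow with the exponent even when h < 1 and one constant
    serves all l <= k. *)
Let K : R := (1 + h) ^+ k.

Let pow_le_K (a : R) l : 0 <= a -> a <= h -> (l <= k)%N -> a ^+ l <= K.
Proof.
move=> a0 ah lk; have h1 : 1 <= 1 + h by rewrite lerDl ltW.
apply: (@le_trans _ _ ((1 + h) ^+ l)); last by rewrite /K ler_weXn2l.
have h10 : 0 <= 1 + h by exact: le_trans h1.
rewrite lerXn2r// ?nnegrE//.
by rewrite (le_trans ah)// lerDr.
Qed.

(** Since l < k, the exponent 2 (k - l) + 1 is 3 + 2 (k - l - 1). One factor K^2 bounds the squared
    weight, another the excess power of c. Summing over l and p multiplies by k^2 (n + 1)^2, and (n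
    + 1)^2 c^3 = h^3 / (n + 1). *)
Let small_bound n : inner P (small_part n) (small_part n) <=
  k%:R ^+ 2 * K ^+ 4 * sigma ^+ 2 * h ^+ 3 / n.+1%:R.
Proof.
set c := step n; have c0 : 0 < c := step_gt0 n.
have ch : c <= h by rewrite ler_pdivrMr// ler_peMr ?(ltW h0)// ler1n.
have K0 : 0 <= K by rewrite exprn_ge0//; lra.
have H (p : 'I_n.+1) (l : 'I_k) :
    inner P (fun w => weight n p l * taylor_remainder l (time n p) c w)
      (fun w => weight n p l * taylor_remainder l (time n p) c w) <=
    K ^+ 4 * (sigma ^+ 2 * c ^+ 3).
  have [Lr rb] := taylor_remainder_bound (ltnW (ltn_ord l)) (time_ge0 n p) (ltW c0).
  rewrite (innerZr _ (L2Z _ Lr) Lr) innerC (innerZr _ Lr Lr) mulrA -expr2.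
  have w0 : 0 <= h - p.+1%:R * c.
    by rewrite subr_ge0 -(nstep n) ler_wpM2r ?(ltW c0)// ler_nat.
  have wh : h - p.+1%:R * c <= h.
    by rewrite gerBl mulr_ge0// ltW.
  have wK : weight n p l ^+ 2 <= K ^+ 2.
    rewrite lerXn2r ?nnegrE//; first by rewrite divr_ge0// exprn_ge0.
    rewrite ler_pdivrMr ?ltr0n ?fact_gt0//.
    rewrite (le_trans (pow_le_K w0 wh (ltnW (ltn_ord l))))//.
    by rewrite ler_peMr// ler1n fact_gt0.
  rewrite (_ : K ^+ 4 = K ^+ 2 * K ^+ 2); last by ring.
  rewrite -[leRHS]mulrA ler_pM ?sqr_ge0 ?inner_ge0// (le_trans rb)//.
  rewrite [leRHS]mulrCA ler_wpM2l ?sqr_ge0//.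
  have -> : (2 * (k - l)).+1 = (3 + (k - l).-1 * 2)%N.
    have : (0 < k - l)%N by rewrite subn_gt0.
    by case: (k - l)%N => // q _; rewrite mulnS addSn mulnC.
  rewrite exprD [leLHS]mulrC ler_wpM2r ?exprn_ge0 ?(ltW c0)//.
  have cq : 0 <= c ^+ (k - l).-1 by rewrite exprn_ge0// ltW.
  rewrite exprM lerXn2r ?nnegrE//.
  apply: pow_le_K => //; first exact: ltW.
  by rewrite (leq_trans (leq_pred _))// leq_subr.
apply: (le_trans (@inner_sum_le _ _ _ P n.+1
   (fun p w => \sum_(l < k) weight n p l * taylor_remainder l (time n p) c w)
   (k%:R ^+ 2 * (K ^+ 4 * (sigma ^+ 2 * c ^+ 3))) _ _)).
- by move=> p; apply: L2_sum => l _; exact: remainder_L2.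
- by move=> p; apply: inner_sum_le => // l; exact: remainder_L2.
rewrite le_eqVlt; apply/orP; left; apply/eqP.
rewrite /c /step; field.
by rewrite addrC natr1 pnatr_eq0.
Qed.

Let error_approx n :
  inner P (fun w => prediction_error w - main_part n w)
    (fun w => prediction_error w - main_part n w) <=
  k%:R ^+ 2 * K ^+ 4 * sigma ^+ 2 * h ^+ 3 / n.+1%:R.
Proof.
rewrite (_ : (fun w => _) = small_part n); first exact: small_bound.
by apply/funext => w; rewrite (error_decomposition n); ring.
Qed.

Lemma prediction_error_orthogonal (V : Omega -> R) : L2 P V ->
  generated_measurable (observed_pi P k X B tn) V ->
  inner P V prediction_error = 0.
Proof.
move=> LV mV.
have cv := cvg_inner_approx LV prediction_error_L2 main_L2 error_approx.
apply: (cvg_unique _ cv) => //.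
rewrite (_ : (fun n => _) = cst 0); first exact: cvg_cst.
apply/funext => n; rewrite /main_part.
have Lr p := (taylor_remainder_bound (leqnn k) (time_ge0 n p) (ltW (step_gt0 n))).1.
rewrite (@inner_sumr _ _ _ _ _ _ V (fun (p : 'I_n.+1) w =>
  weight n p k * taylor_remainder k (time n p) (step n) w))//; last first.
  by move=> p; exact: L2Z.
rewrite big1// => p _; rewrite innerZr//.
by rewrite (taylor_remainder_orthogonal tn0 (time_ge n p) (ltW (step_gt0 n)) LV mV) mulr0.
Qed.

Lemma prediction_error_variance :
  inner P prediction_error prediction_error =
  sigma ^+ 2 * h ^+ (2 * k + 1) / (k`!%:R ^+ 2 * (2 * k + 1)%:R).
Proof.
have cv := cvg_inner_approx_diag prediction_error_L2 main_L2 error_approx.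
pose A := sigma ^+ 2 * h ^+ (2 * k + 1) / k`!%:R ^+ 2.
have k0 : k`!%:R != 0 :> R by rewrite pnatr_eq0 -lt0n fact_gt0.
have -> : sigma ^+ 2 * h ^+ (2 * k + 1) / (k`!%:R ^+ 2 * (2 * k + 1)%:R) =
    A * (2 * k).+1%:R^-1 by rewrite /A addn1 invfM mulrA.
apply: (cvg_unique _ cv) => //.
rewrite (_ : (fun n => _) = (fun n => A * \sum_(p < n.+1)
    (p%:R / n.+1%:R : R) ^+ (2 * k) / n.+1%:R)).
  by apply: cvgM; [exact: cvg_cst|exact: cvg_riemann_sum_pow].
apply/funext => n; set c := step n.
have Lr p : L2 P (taylor_remainder k (time n p) c) :=
  (taylor_remainder_bound (leqnn k) (time_ge0 n p) (ltW (step_gt0 n))).1.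
have LF (p : 'I_n.+1) : L2 P (fun w =>
  weight n p k * taylor_remainder k (time n p) c w) by exact: L2Z.
(* The earlier remainder is observed by [time n q], when the later one starts. *)
have orth (p q : nat) : (p < q)%N ->
    inner P (taylor_remainder k (time n p) c) (taylor_remainder k (time n q) c) = 0.
  move=> pq; apply: (taylor_remainder_orthogonal (time_ge0 n q) (lexx _) (ltW (step_gt0 n)) (Lr p)).
  apply: (taylor_remainder_observed (time_ge0 n p) (ltW (step_gt0 n))).
  by rewrite -timeS lerD2l ler_wpM2r ?(ltW (step_gt0 n))// ler_nat.
have diag (p : 'I_n.+1) : \sum_(q < n.+1)
    inner P (fun w => weight n p k * taylor_remainder k (time n p) c w)
      (fun w => weight n q k * taylor_remainder k (time n q) c w) =
    weight n p k ^+ 2 * (sigma ^+ 2 * c).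
  rewrite (bigD1 p)//= big1 ?addr0; last first.
    move=> q qp; rewrite (innerZr _ (LF _) (Lr q)) innerC (innerZr _ (Lr _) (Lr _)).
    have : (q : nat) != p by [].
    rewrite neq_ltn => /orP[/orth ->|/orth]; first by rewrite !mulr0.
    by rewrite innerC => ->; rewrite !mulr0.
  rewrite (innerZr _ (LF p) (Lr _)) innerC (innerZr _ (Lr _) (Lr _)).
  by rewrite (inner_taylor_remainder_noise (time_ge0 n p) (ltW (step_gt0 n))) -/c; ring.
rewrite (inner_sum_sum LF) (eq_bigr _ (fun p _ => diag p)).
(* Counting subintervals backwards from T turns the weight at a right endpoint into (h p / (n +
   1))^k / k!, a left-endpoint Riemann sum for the power 2k. *)
rewrite mulr_sumr (reindex_inj rev_ord_inj); apply: eq_bigr => p _.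
rewrite /weight (_ : h - _ * _ = h * (p%:R / n.+1%:R)); last first.
  rewrite /= subSS -subSn ?ltn_ord//; last by rewrite -ltnS.
  rewrite natrB; last by rewrite ltnW.
  by rewrite mulrBl nstep /step; ring.
have hE : h ^+ (2 * k + 1) = h * (h ^+ k) ^+ 2 by rewrite addn1 exprS mulnC exprM.
rewrite /A /c /step hE (exprMn k h) [(2 * k)%N]mulnC !exprM.
move: (h ^+ k) ((p%:R / n.+1%:R) ^+ k) => hk yk; field.
by rewrite k0 addrC natr1 pnatr_eq0.
Qed.

End horizon.

End prediction_error.

(** * Means and the Wasserstein distance *)

Section means.
Context {R : realType} {d : nat}.
Local Notation Rd := (d.-tuple R).
Implicit Types (mu nu rho : pprobability Rd R) (a b : Rd).

(* Written with positive and negative parts so that measurability in [mu] is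
   immediate; junk unless the first moments are finite. *)
Definition coord_mean (i : 'I_d) mu : R :=
  fine (\int[mu]_z (Num.max (tnth z i) 0)%:E) -
  fine (\int[mu]_z (Num.max (- tnth z i) 0)%:E).

Lemma measurable_coord (i : 'I_d) : measurable_fun setT (fun z : Rd => tnth z i).
Proof. exact: measurable_tnth. Qed.

Lemma measurable_integral_pprobability (f : Rd -> R) :
  measurable_fun setT f -> (forall z, 0 <= f z) ->
  measurable_fun setT (fun mu : pprobability Rd R => fine (\int[mu]_z (f z)%:E)).
Proof.
move=> mf f0; rewrite (_ : (fun _ => _) =
  fine \o (fun mu : pprobability Rd R => (\int[mu]_z (f z)%:E)%E))//.
apply: measurableT_comp; first exact: fine_measurable.
(* The identity on the space of probability measures is itself a probability kernel, so
   measurability of kernel integrals applies. *)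
pose ker := kprobability (@measurable_id _ (pprobability Rd R) setT).
apply: (@measurable_fun_integral_kernel _ _ _ _ R ker).
- by move=> U mU; exact: measurable_kernel.
- by move=> z; rewrite lee_fin.
- exact/measurable_EFinP.
Qed.

Lemma measurable_coord_mean (i : 'I_d) : measurable_fun setT (coord_mean i).
Proof.
have m1 := measurable_coord i.
apply: measurable_funB; apply: measurable_integral_pprobability.
- by apply: measurable_maxr => //; exact: measurable_cst.
- by move=> z; rewrite le_max lexx orbT.
- by apply: measurable_maxr; [exact: measurableT_comp|exact: measurable_cst].
- by move=> z; rewrite le_max lexx orbT.
Qed.

Lemma measurable_sqdist0 : measurable_fun setT (fun z : Rd => sqdist z vzero).
Proof.
apply: measurable_sum => i; apply: measurable_funX; apply: measurable_funB => //.
exact: measurable_coord.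
Qed.

Lemma L2_coord mu (i : 'I_d) : finite_second_moment mu ->
  L2 mu (fun z => tnth z i).
Proof.
move=> fmu; split; first exact: measurable_coord.
apply/integrableP; split.
  by apply/measurable_EFinP/measurable_funX; exact: measurable_coord.
rewrite /finite_second_moment in fmu; apply: (le_lt_trans _ fmu); apply: ge0_le_integral => //.
  by apply: measurableT_comp => //; apply/measurable_EFinP/measurable_funX;
    exact: measurable_coord.
  by apply/measurable_EFinP; exact: measurable_sqdist0.
move=> z _; rewrite gee0_abs ?lee_fin ?sqr_ge0// /sqdist (bigD1 i)//=.
by rewrite tnth_mktuple subr0 lerDl sumr_ge0// => j _; exact: sqr_ge0.
Qed.

Lemma coord_meanE mu (i : 'I_d) : L2 mu (fun z => tnth z i) ->
  coord_mean i mu = inner mu (cst 1) (fun z => tnth z i).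
Proof.
move=> Lz; have L1 := L2_cst mu 1.
have mz := Lz.1.
have Lp : L2 mu (fun z => Num.max (tnth z i) 0).
  apply: L2_le Lz _.
    by apply: measurable_maxr => //; exact: measurable_cst.
  move=> z; case: (leP (tnth z i) 0) => // _.
  by rewrite expr0n/= sqr_ge0.
have Ln : L2 mu (fun z => Num.max (- tnth z i) 0).
  apply: L2_le Lz _.
    by apply: measurable_maxr; [exact: measurableT_comp|exact: measurable_cst].
  move=> z; case: (leP (- tnth z i) 0) => _; last by rewrite sqrrN.
  by rewrite expr0n/= sqr_ge0.
have E f : fine (\int[mu]_z (f z)%:E) = inner mu (cst 1) f.
  by rewrite /inner /Rintegral; congr fine; apply: eq_integral => z _; rewrite mul1r.
rewrite /coord_mean !E -innerBr//; congr inner; apply/funext => z.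
by case: (leP (tnth z i) 0); case: (leP (- tnth z i) 0); lra.
Qed.

Lemma integral_sum_sqr (dO : measure_display) (Omega : measurableType dO)
    (P : probability Omega R) (F : 'I_d -> Omega -> R) :
  (forall i, L2 P (F i)) ->
  (\int[P]_w (\sum_(i < d) F i w ^+ 2)%:E)%E = (\sum_(i < d) inner P (F i) (F i))%:E.
Proof.
move=> LF; under eq_integral do rewrite -sumEFin.
rewrite ge0_integral_sum//.
- by rewrite -sumEFin; apply: eq_bigr => i _; rewrite EFin_inner.
- by move=> i; apply/measurable_EFinP/measurable_funX; exact: (LF i).1.
- by move=> i w _; rewrite lee_fin sqr_ge0.
Qed.

End means.

(** * Wasserstein distance, means and translates *)

Section wasserstein_distance.
Context {R : realType} {d : nat}.
Local Notation Rd := (d.-tuple R).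
Implicit Types (mu nu rho : pprobability Rd R) (a b : Rd).

Lemma sqr_W2 mu nu : (W2 mu nu ^+ 2 = ereal_inf
    [set (\int[g]_z (sqdist z.1 z.2)%:E)%E | g in coupling mu nu])%E.
Proof.
rewrite /W2 sqr_sqrte//; apply: le_ereal_inf_tmp => _ [g _ <-].
apply: integral_ge0 => z _; rewrite lee_fin; apply: sumr_ge0 => i _.
exact: sqr_ge0.
Qed.

(* Jensen's inequality, applied to each coordinate of a coupling. *)
Lemma sqr_W2_ge mu nu : finite_second_moment mu -> finite_second_moment nu ->
  ((\sum_(i < d) (coord_mean i mu - coord_mean i nu) ^+ 2)%:E <= W2 mu nu ^+ 2)%E.
Proof.
move=> fmu fnu; rewrite sqr_W2; apply: le_ereal_inf_tmp => _ [g gc <-].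
have law1 (A : set Rd) : measurable A -> g (fst @^-1` A) = mu A.
  move=> mA; rewrite -(gc A mA).1; congr (g _).
  by apply/seteqP; split=> [z Az|z []].
have law2 (A : set Rd) : measurable A -> g (snd @^-1` A) = nu A.
  move=> mA; rewrite -(gc A mA).2; congr (g _).
  by apply/seteqP; split=> [z Az|z []].
have m1 : measurable_fun setT (@fst Rd Rd) by exact: measurable_fst.
have m2 : measurable_fun setT (@snd Rd Rd) by exact: measurable_snd.
have L1 i := L2_of_law m1 law1 (L2_coord i fmu).
have L2' i := L2_of_law m2 law2 (L2_coord i fnu).
rewrite /sqdist integral_sum_sqr; last by move=> i; exact: (L2B (L1 i) (L2' i)).
rewrite lee_fin; apply: ler_sum => i _.
rewrite (coord_meanE (L2_coord i fmu)) (coord_meanE (L2_coord i fnu)).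
rewrite -(inner_of_law m1 law1 (L2_cst mu 1) (L2_coord i fmu)).
rewrite -(inner_of_law m2 law2 (L2_cst nu 1) (L2_coord i fnu)).
have Lc : L2 g (cst 1) := L2_cst _ _.
rewrite -innerBr//.
apply: (le_trans (cauchy_schwarz_inner Lc (L2B (L1 i) (L2' i)))).
by rewrite inner_cst !mul1r.
Qed.

Lemma L2_translation rho a i : finite_second_moment rho ->
  L2 rho (fun z => tnth (translation a z) i).
Proof.
move=> frho; rewrite (_ : (fun z => _) = fun z => tnth z i + tnth a i).
  by apply: L2D; [exact: L2_coord|exact: L2_cst].
by apply/funext => z; rewrite tnth_mktuple.
Qed.

Lemma translate_finite_second_moment rho a : finite_second_moment rho ->
  finite_second_moment (translate rho a).
Proof.
move=> frho; rewrite /finite_second_moment ge0_integral_distribution//=.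
- under eq_integral => z _.
    rewrite /sqdist; under eq_bigr do rewrite [tnth vzero _]tnth_mktuple subr0.
    over.
  by rewrite integral_sum_sqr ?ltry// => i; exact: L2_translation.
- by apply/measurable_EFinP; exact: measurable_sqdist0.
- by move=> z; rewrite lee_fin; apply: sumr_ge0 => i _; exact: sqr_ge0.
Qed.

Lemma coord_mean_translate rho a i : finite_second_moment rho ->
  coord_mean i (translate rho a) = coord_mean i rho + tnth a i.
Proof.
move=> frho; have Lt := L2_coord i (translate_finite_second_moment a frho).
have Lr := L2_coord i frho; have Lc := L2_cst rho 1.
rewrite !coord_meanE//.
have law (A : set Rd) : measurable A -> rho (translation a @^-1` A) = translate rho a A.
  by [].
rewrite -(inner_of_law (measurable_translation a) law (L2_cst _ 1) Lt).
rewrite -[cst 1 \o _]/(cst 1).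
rewrite (_ : (fun z => tnth z i) \o translation a =
  fun z => tnth z i + cst (tnth a i) z); last first.
  by apply/funext => z; rewrite [LHS]tnth_mktuple.
rewrite innerDr//; last exact: L2_cst.
by congr (_ + _); rewrite [LHS]inner_cst mul1r.
Qed.

Lemma sqr_W2_translate rho a b : finite_second_moment rho ->
  (W2 (translate rho a) (translate rho b) ^+ 2 = (sqdist a b)%:E)%E.
Proof.
move=> frho; apply/eqP; rewrite eq_le; apply/andP; split; last first.
  have := sqr_W2_ge (translate_finite_second_moment a frho)
    (translate_finite_second_moment b frho).
  apply: le_trans; rewrite lee_fin; apply: ler_sum => i _.
  rewrite !coord_mean_translate// (_ : _ - _ = tnth a i - tnth b i)//; ring.
(* Synchronous coupling: both translates move the same z, so the transport cost is constant. *)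
have mf : measurable_fun setT (fun z : Rd => (translation a z, translation b z)).
  by apply: measurable_fun_pair; exact: measurable_translation.
pose f : {RV rho >-> (Rd * Rd)%type} :=
  HB.pack (fun z : Rd => (translation a z, translation b z))
    (isMeasurableFun.Build _ _ _ _ _ mf).
rewrite sqr_W2; apply: ereal_inf_lbound; exists (distribution rho f).
  move=> A mA; split.
    by rewrite /translate /distribution/= /pushforward; congr (rho _);
      apply/seteqP; split=> [z []|z Az].
  by rewrite /translate /distribution/= /pushforward; congr (rho _);
    apply/seteqP; split=> [z []|z Az].
rewrite ge0_integral_distribution; last 2 first.
- apply/measurable_EFinP; apply: measurable_sum => i; apply: measurable_funX.
  by apply: measurable_funB;
    [exact: (measurableT_comp (measurable_coord i) measurable_fst)
    |exact: (measurableT_comp (measurable_coord i) measurable_snd)].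
- by move=> z; rewrite lee_fin; apply: sumr_ge0 => i _; exact: sqr_ge0.
rewrite (eq_integral (cst (sqdist a b)%:E)); last first.
  move=> z _ /=; congr EFin; apply: eq_bigr => i _.
  by rewrite !tnth_mktuple; ring.
rewrite integral_cst// -[RHS]mule1; congr (_ * _)%E.
exact: probability_setT.
Qed.

(** The mass that the translate by a gives to A is the rho-mass of the section at a of the set of
    (a, z) with z + a in A, so this is the measurability of section masses behind Fubini's
    theorem. *)
Lemma measurable_translate rho : measurable_fun setT (translate rho).
Proof.
apply: (measurability (@pset _ _ _ : set (set (pprobability Rd R)))) => //.
move=> _ [_ [r r01] [A mA <-]] <-; rewrite setTI.
pose S : set (Rd * Rd) := (fun u => vadd u.2 u.1) @^-1` A.
have mS : measurable S.
  rewrite -[S]setTI.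
  have : measurable_fun setT (fun u : Rd * Rd => vadd u.2 u.1).
    apply/measurable_fun_tnthP => i.
    rewrite (_ : _ \o _ = fun u : Rd * Rd => tnth u.2 i + tnth u.1 i).
      apply: measurable_funD; apply: (measurableT_comp (measurable_coord i)).
        exact: measurable_snd.
      exact: measurable_fst.
    by apply/funext => u /=; rewrite tnth_mktuple.
  by apply.
have mx := measurable_fun_xsection rho mS.
have -> : translate rho @^-1` mset A r = (rho \o xsection S) @^-1` [set x | (x < r%:E)%E].
  apply/seteqP; split => a /=; rewrite /mset/= /translate /distribution/= /pushforward/=;
  congr (is_true (_ < _)%E); congr (rho _); apply/seteqP; split => z /=;
  by rewrite /xsection/= inE.
rewrite -[_ @^-1` _]setTI; apply: mx => //.
rewrite (_ : [set x | _] = `]-oo, r%:E[%classic).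
  exact: emeasurable_itv.
by apply/seteqP; split => x /=; rewrite in_itv.
Qed.

(** The integral of a nonnegative function is a supremum over simple functions below it, hence
    monotone in any case. It serves for the risk, because measurability of the squared distance as a
    function of the outcome is not established for a general forecast. *)
Lemma le_integral_nonmeasurable (dO : measure_display) (Omega : measurableType dO)
    (P : probability Omega R) (f g : Omega -> \bar R) :
  (forall w, 0 <= f w)%E -> (forall w, f w <= g w)%E ->
  (\int[P]_w f w <= \int[P]_w g w)%E.
Proof.
move=> f0 fg; have g0 w := le_trans (f0 w) (fg w).
rewrite !ge0_integralTE//; apply: ereal_sup_le.
by move=> _ [u uf <-]; exists u => // w; exact: le_trans (uf w) (fg w).
Qed.

End wasserstein_distance.

(** * Forecasts *)

Section forecast.
Context {R : realType} {d : nat} {dO : measure_display} {Omega : measurableType dO}.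
Variable P : probability Omega R.
Local Notation Rd := (d.-tuple R).
Variables (k : nat) (sigma h tn : R) (X : nat -> R -> Omega -> Rd) (B : R -> Omega -> Rd).
Hypothesis XB : integrated_white_noise P k sigma X B.
Hypotheses (h0 : 0 < h) (tn0 : 0 < tn).
Variable rho : pprobability Rd R.
Hypothesis frho : finite_second_moment rho.

Local Notation mu := (fun t w => translate rho (X 0%N t w)).

Let past_generator : set (set Omega) :=
  \bigcup_(t in `[0, tn]%classic) preimage_set_system setT (mu t) measurable.

Local Notation err i := (prediction_error k X i h tn).
Let tn_ge0 : 0 <= tn. Proof. exact: ltW. Qed.

Lemma past_observed : past_generator `<=` <<s observed_pi P k X B tn >>.
Proof.
suff H u : `[0, tn]%classic u -> measurable_wrt <<s observed_pi P k X B tn >> (mu u).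
  by move=> A [u uI]; exact: H.
rewrite /= in_itv/= => /andP[u0 utn]; apply/generated_measurableP.
apply: (measurableT_comp (measurable_translate rho)).
by apply: generated_measurable_tuple => i; exact: (observed_derivative XB).
Qed.

(* Backward difference quotients only involve the past. *)
Lemma derivative_past j (u : R) i : (j <= k)%N -> 0 < u -> u <= tn ->
  generated_measurable past_generator (fun w => tnth (X j u w) i).
Proof.
elim: j u => [|j IHj] u jk u0 utn.
  rewrite (_ : (fun w => _) = fun w => coord_mean i (mu u w) - coord_mean i rho).
    apply: measurable_funB; last exact: measurable_cst.
    apply: (measurableT_comp (measurable_coord_mean i)).
    apply/generated_measurableP; apply: sigma_of_generator.
    by rewrite /= in_itv/= (ltW u0).
  by apply/funext => w; rewrite coord_mean_translate// addrC addKr.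
(* The denominator starts at 2 so that u + c n stays strictly positive, as the induction hypothesis
   demands. *)
pose c n : R := - (u / n.+2%:R).
have cn0 n : c n < 0 by rewrite oppr_lt0 divr_gt0.
have ucn n : 0 < u + c n.
  by rewrite subr_gt0 ltr_pdivrMr// ltr_pMr// ltr1n.
apply: (@measurable_fun_cvg _ (g_sigma_algebraType past_generator) _ setT
  (fun n w => (c n)^-1 * (tnth (X j (u + c n) w) i - tnth (X j u w) i))).
  move=> n; apply: measurable_funM; first exact: measurable_cst.
  apply: measurable_funB; apply: IHj => //; try exact: ltnW.
  by rewrite (le_trans _ utn)// gerDl ltW.
move=> w _; have [df dE] := iwn_derive XB w i jk u0.
have := df; rewrite /derivable => /cvg_ex[/= l] dl.
have lE : l = tnth (X j.+1 u w) i.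
  by rewrite -dE /derive; apply/esym/cvg_lim.
rewrite -lE.
have /cvgr_dnbhsP/(_ c) H := dl.
rewrite (_ : (fun n => _) = (fun n => (c n)^-1 *:
  (tnth (X j (c n *: 1 + u) w) i - tnth (X j u w) i))).
  apply: H; split; first by move=> n; rewrite lt_eqF.
  rewrite /c -oppr0; apply: cvgN; rewrite -(mulr0 u).
  apply: cvgM; first exact: cvg_cst.
  by have := @cvg_harmonic R; rewrite -cvg_shiftS.
by apply/funext => n; rewrite /GRing.scale/= mulr1 (addrC u).
Qed.

Lemma taylor_past : generated_measurable past_generator (taylor k h tn X).
Proof.
apply: generated_measurable_tuple => i.
rewrite (_ : (fun w => _) = fun w => \sum_(j < k.+1)
    h ^+ j / j`!%:R * tnth (X j tn w) i).
  apply: measurable_sum => j; apply: measurable_funM; first exact: measurable_cst.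
  by apply: derivative_past => //; rewrite -ltnS.
by apply/funext => w; rewrite tnth_mktuple.
Qed.

Lemma observed_measurable_fun (V : Omega -> R) :
  generated_measurable (observed_pi P k X B tn) V -> measurable_fun setT V.
Proof.
move=> mV mT A mA.
suff : <<s observed_pi P k X B tn >> `<=` measurable by apply; exact: mV.
apply: smallest_sub; first exact: sigma_algebra_measurable.
exact: (observed_pi_measurable XB).
Qed.

Lemma integral_past_error A i : <<s past_generator >> A ->
  (\int[P]_(w in A) (err i w)%:E = 0)%E.
Proof.
move=> pA; have oA := sub_g_sigma past_observed pA.
have mV : generated_measurable (observed_pi P k X B tn) (\1_A : Omega -> R).
  exact: (@measurable_indic _ (g_sigma_algebraType (observed_pi P k X B tn))).
have LV : L2 P (\1_A : Omega -> R).
  apply: (@L2_bounded _ _ _ _ _ 1); first exact: observed_measurable_fun.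
  by move=> w; rewrite indicE; case: (w \in A); rewrite ?normr1 ?normr0.
have Le := prediction_error_L2 XB i h0 tn_ge0.
have E := prediction_error_orthogonal XB i h0 tn_ge0 LV mV.
rewrite integral_mkcond.
rewrite (eq_integral (fun w => (\1_A w * err i w)%:E)); last first.
  move=> w _; rewrite patchE indicE; case: ifPn => _; first by rewrite mul1r.
  by rewrite mul0r.
rewrite -[LHS]fineK; last exact: (integrable_fin_num measurableT (L2_integrableM LV Le)).
by congr EFin; exact: E.
Qed.

(** [V] is not assumed square-integrable: either the right-hand side is infinite, or V - err is in
    L^2, and then so is V, and orthogonality applies. *)
Lemma integral_sqr_sub_error i (V : Omega -> R) :
  generated_measurable past_generator V ->
  ((inner P (err i) (err i))%:E <= \int[P]_w ((V w - err i w) ^+ 2)%:E)%E.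
Proof.
move=> pV; have oV := generated_measurable_sub past_observed pV.
have mV := observed_measurable_fun oV.
have Le := prediction_error_L2 XB i h0 tn_ge0.
have mVe : measurable_fun setT (fun w => V w - err i w).
  by apply: measurable_funB => //; exact: Le.1.
have [fin|] := ltP (\int[P]_w ((V w - err i w) ^+ 2)%:E)%E +oo%E; last first.
  by rewrite leye_eq => /eqP ->; rewrite leey.
have LVe : L2 P (fun w => V w - err i w).
  split => //; apply/integrableP; split.
    by apply/measurable_EFinP; exact: measurable_funX.
  by under eq_integral do rewrite gee0_abs ?lee_fin ?sqr_ge0//.
have LV : L2 P V.
  rewrite (_ : V = fun w => (V w - err i w) + err i w); first exact: L2D.
  by apply/funext => w; rewrite subrK.
rewrite EFin_inner// lee_fin inner_sqrB//.
rewrite (prediction_error_orthogonal XB i h0 tn_ge0 LV oV) mulr0 subr0.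
by rewrite lerDr inner_ge0.
Qed.

End forecast.

Theorem theorem2 (R : realType) (d : nat)
    (dO : measure_display) (Omega : measurableType dO)
    (P : probability Omega R)
    (k : nat) (sigma h tn : R)
    (sigma_gt0 : 0 < sigma) (h_gt0 : 0 < h) (tn_gt0 : 0 < tn)
    (rho : pprobability (d.-tuple R) R) (rho_P2 : finite_second_moment rho)
    (X : nat -> R -> Omega -> d.-tuple R) (B : R -> Omega -> d.-tuple R)
    (XB : integrated_white_noise P k sigma X B) :
  let mu : R -> Omega -> pprobability (d.-tuple R) R :=
    fun t w => translate rho (X 0%N t w) in
  let past : set (set Omega) := sigma_of `[0, tn] mu in
  let bound : R := d%:R * sigma ^+ 2 * h ^+ (2 * k + 1) /
                   (k`!%:R ^+ 2 * (2 * k + 1)%:R) in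
  let risk : (Omega -> pprobability (d.-tuple R) R) -> \bar R :=
    fun nu => (\int[P]_w (W2 (nu w) (mu (tn + h)%R w) ^+ 2))%E in
  let extrapolator : Omega -> pprobability (d.-tuple R) R :=
    fun w => translate rho (taylor k h tn X w) in
  (forall nu, forecaster past nu -> (bound%:E <= risk nu)%E) /\
  [/\ forecaster past extrapolator,
      conditional_mean P past (X 0%N (tn + h)) (taylor k h tn X) &
      risk extrapolator = bound%:E].

Proof.
move=> mu past bound risk extrapolator.
have tn_ge0 : 0 <= tn by exact: ltW.
pose G : set (set Omega) :=
  \bigcup_(t in `[0, tn]%classic) preimage_set_system setT (mu t) measurable.
have mtaylor : generated_measurable G (taylor k h tn X).
  exact: (taylor_past h XB tn_gt0 rho_P2).
have boundE : (\sum_(i < d) inner P (prediction_error k X i h tn)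
    (prediction_error k X i h tn)) = bound.
  rewrite (eq_bigr (fun _ => sigma ^+ 2 * h ^+ (2 * k + 1) /
    (k`!%:R ^+ 2 * (2 * k + 1)%:R))).
    by rewrite sumr_const card_ord -[LHS]mulr_natl /bound !mulrA.
  by move=> i _; exact: (prediction_error_variance XB).
have errE w i : tnth (X 0%N (tn + h) w) i - tnth (taylor k h tn X w) i =
    prediction_error k X i h tn w by [].
split; [|split].
- move=> nu [fnu mnu].
  (* Centred so that V minus the prediction error is the difference of the means of [nu] and of the
     target, while V itself depends on the past only. *)
  pose V i w := coord_mean i (nu w) - coord_mean i rho - tnth (taylor k h tn X w) i.
  apply: (@le_trans _ _ (\int[P]_w
    (\sum_(i < d) (V i w - prediction_error k X i h tn w) ^+ 2)%:E)%E).
    have mV i : generated_measurable G (V i).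
      apply: measurable_funB; last exact: generated_measurable_tnth.
      apply: measurable_funB; last exact: measurable_cst.
      apply: (measurableT_comp (measurable_coord_mean i)).
      exact/generated_measurableP.
    have mVe i : measurable_fun setT (fun w => V i w - prediction_error k X i h tn w).
      have oV := generated_measurable_sub (past_observed (tn := tn) (rho := rho) XB) (mV i).
      have mVi := observed_measurable_fun XB oV.
      by apply: measurable_funB => //; exact: (prediction_error_L2 XB i h_gt0 tn_ge0).1.
    under eq_integral do rewrite -sumEFin.
    rewrite ge0_integral_sum//.
    + rewrite -boundE -sumEFin; apply: lee_sum => i _.
      exact: (integral_sqr_sub_error XB h_gt0 tn_gt0 i (mV i)).
    + by move=> i; apply/measurable_EFinP/measurable_funX; exact: mVe.
    + by move=> i w _; rewrite lee_fin sqr_ge0.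
  apply: le_integral_nonmeasurable.
    by move=> w; rewrite lee_fin; apply: sumr_ge0 => i _; exact: sqr_ge0.
  move=> w; have fX := translate_finite_second_moment (X 0%N (tn + h) w) rho_P2.
  apply: le_trans (sqr_W2_ge (fnu w) fX); rewrite lee_fin; apply: ler_sum => i _.
  rewrite coord_mean_translate// /V /prediction_error.
  rewrite (_ : _ - _ = coord_mean i (nu w) - (coord_mean i rho + tnth (X 0 (tn + h) w) i))//.
  ring.
- split; first by move=> w; exact: translate_finite_second_moment.
  apply/generated_measurableP.
  exact: (measurableT_comp (measurable_translate rho) mtaylor).
- split; first exact/generated_measurableP.
  move=> i; split.
    have := L2_integrableM (L2_cst P 1) (prediction_error_L2 XB i h_gt0 tn_ge0).
    by apply: eq_integrable => // w _; rewrite /= mul1r.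
  by move=> A pA; exact: (integral_past_error XB h_gt0 tn_gt0 i pA).
- rewrite /risk -boundE -integral_sum_sqr; last first.
    by move=> i; exact: (prediction_error_L2 XB).
  apply: eq_integral => w _; rewrite sqr_W2_translate//; congr EFin.
  apply: eq_bigr => i _; rewrite -errE; ring.
Qed.
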